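(* Let $M>1$, $R\ge 0$, $\sigma>0$, and let $\gamma=R^2/\sigma^2$. For $(\alpha,\beta)\in\mathbb{R}_{\ge0}\times\mathbb{R}_{\ge0}$ let $\mathfrak{D}(\alpha,\beta)$ be the worst-case terminal error of two-step stochastic gradient defined in the context, and let $\bar\alpha,\eta,\gamma_1,\gamma_2,\gamma_\star,\hat a,T,U,(\alpha^\star,\beta^\star)$ be as in the context. (1) If $\gamma\neq\gamma_\star$, then $(\alpha^\star,\beta^\star)$ is the unique global minimizer of $\mathfrak{D}$ over $\mathbb{R}_{\ge0}\times\mathbb{R}_{\ge0}$. (2) If $\gamma=\gamma_\star$, then the set of global minimizers is exactly $$\operatorname*{argmin}_{(\alpha,\beta)\in\mathbb{R}_{\ge0}\times\mathbb{R}_{\ge0}}\mathfrak{D}(\alpha,\beta)=\left\{(\bar\alpha,\bar\alpha),\ \left(\frac{2}{1+\eta},\frac{2}{1+2M-\eta}\right)\right\}.$$ (3) For every $\gamma\ge0$, $$\min_{(\alpha,\beta)\in\mathbb{R}_{\ge0}\times\mathbb{R}_{\ge0}}\mathfrak{D}(\alpha,\beta)=\mathfrak{D}(\alpha^\star,\beta^\star)=\sigma^2V^\star(\gamma),$$ where $$V^\star(\gamma):=\begin{cases}\dfrac{\gamma}{1+2\gamma}, & 0\le\gamma\le\gamma_1,\\[2mm] \dfrac{\gamma(M-1)^2+4}{\gamma(M-1)^2+4+(M+1)^2}, & \gamma_1\le\gamma\le\gamma_2,\\[2mm] \gamma T(1)+U(1), & \gamma_2\le\gamma\le\gamma_\star,\\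 \gamma T(\hat a)+U(\hat a), & \gamma\ge\gamma_\star,\end{cases}$$ and the adjacent expressions in this definition agree at the boundary thresholds $\gamma_1$, $\gamma_2$ and $\gamma_\star$.
   Context: Function class. For $M>1$ and $d\ge 1$, $\mathcal{F}_{1,M}$ denotes the set of differentiable functions $f:\mathbb{R}^d\to\mathbb{R}$ that are $1$-strongly convex and $M$-smooth, i.e. for all $x,y\in\mathbb{R}^d$: $f(y)\ge f(x)+\langle\nabla f(x),y-x\rangle+\frac12\|y-x\|^2$ and $\|\nabla f(x)-\nabla f(y)\|\le M\|x-y\|$. Norms are Euclidean. Each such $f$ has a unique minimizer $x_\star$. Stochastic oracle. An oracle for $f$ consists of a finite (nonempty) index set $\mathcal{I}$ and a map $g:\mathbb{R}^d\times\mathcal{I}\to\mathbb{R}^d$ such that for every $x\in\mathbb{R}^d$: $\frac{1}{|\mathcal{I}|}\sum_{i\in\mathcal{I}}g(x,i)=\nabla f(x)$ (unbiasedness) and $\frac{1}{|\mathcal{I}|}\sum_{i\in\mathcal{I}}\|g(x,i)-\nabla f(x)\|^2\le\sigma^2$ (variance bound). Indices are sampled uniformly from $\mathcal I$, independently across iterations. Two-step stochastic gradient. Given $x_0\in\mathbb{R}^d$ and stepsizes $(\alpha,\beta)\in\mathbb{R}_{\ge0}\times\mathbb{R}_{\ge0}$, for $(i,j)\in\mathcal{I}\times\mathcal{I}$ set $x_1^{(i)}=x_0-\alpha g(x_0,i)$ and $x_2^{(i,j)}=x_1^{(i)}-\beta g(x_1^{(i)},j)$. Worst-case terminal error. $$\mathfrak{D}(\alpha,\beta):=\sup\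 \frac{1}{|\mathcal{I}|^2}\sum_{(i,j)\in\mathcal{I}\times\mathcal{I}}\|x_2^{(i,j)}-x_\star\|^2,$$ the supremum being over all dimensions $d\ge2$, all $f\in\mathcal{F}_{1,M}$ on $\mathbb{R}^d$, all $x_0\in\mathbb{R}^d$ with $\|x_0-x_\star\|\le R$, and all stochastic oracles for $f$, i.e. all pairs $(\mathcal{I},g)$ consisting of an arbitrary finite nonempty index set $\mathcal{I}$ and a map $g:\mathbb{R}^d\times\mathcal{I}\to\mathbb{R}^d$ with $\frac{1}{|\mathcal{I}|}\sum_{i\in\mathcal{I}}g(x,i)=\nabla f(x)$ and $\frac{1}{|\mathcal{I}|}\sum_{i\in\mathcal{I}}\|g(x,i)-\nabla f(x)\|^2\le\sigma^2$ for every $x\in\mathbb{R}^d$. Parameters. $\gamma:=R^2/\sigma^2$, $\bar\alpha:=\frac{2}{M+1}$, $\eta:=\sqrt{2M^2-2M+1}$, $\gamma_1:=\frac{2}{M-1}$, $\gamma_2:=\frac{2(M^2+3)}{(M-1)^3}$, $\hat a:=\frac{M-1+\eta}{M}$ (so $\hat a>1$). For $\zeta\ge1$, $$T(\zeta):=\frac{(M-1)^4\zeta^2}{(M\zeta+1)^2(\zeta+M)^2},\qquad U(\zeta):=\frac{(\zeta+1)^2\bigl((2M^2-2M+1)\zeta^2+2M\zeta+1\bigr)}{(M\zeta+1)^2(\zeta+M)^2},$$ and $\gamma_\star:=\frac{U(\hat a)-U(1)}{T(1)-T(\hat a)}$ (the denominator is positive). The thresholds satisfy $0<\gamma_1<\gamma_2<\gamma_\star$.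 Proposed schedule. $$(\alpha^\star,\beta^\star)=\begin{cases}\left(\dfrac{\gamma}{1+\gamma},\dfrac{\gamma}{1+2\gamma}\right), & 0\le\gamma\le\gamma_1,\\[2mm] \left(\bar\alpha,\dfrac{\gamma(M-1)^2+4}{\gamma(M-1)^2+4+(M+1)^2}\right), & \gamma_1\le\gamma\le\gamma_2,\\[2mm] (\bar\alpha,\bar\alpha), & \gamma_2\le\gamma<\gamma_\star,\\ \left(\dfrac{2}{1+\eta},\dfrac{2}{1+2M-\eta}\right), & \gamma\ge\gamma_\star.\end{cases}$$ *)

(* Defs.v *)
From HB Require Import structures.
From mathcomp Require Import all_boot all_order all_algebra.
From mathcomp Require Import all_classical all_reals all_analysis.

Set Implicit Arguments.
Unset Strict Implicit.
Unset Printing Implicit Defensive.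

Import Order.TTheory GRing.Theory Num.Theory.
Import numFieldNormedType.Exports.

Local Open Scope classical_set_scope.
Local Open Scope ring_scope.

Definition dotv (R : realType) (d : nat) (u v : 'rV[R]_d) : R :=
  \sum_(i < d) u 0 i * v 0 i.

(* The library norm on 'rV[R]_d is the sup norm; it serves below only through
   [differentiable], which does not depend on the choice of norm. *)
Definition enorm (R : realType) (d : nat) (u : 'rV[R]_d) : R :=
  Num.sqrt (dotv u u).

(* The gradient only where f is differentiable. *)
Definition grad (R : realType) (d : nat) (f : 'rV[R]_d -> R) (x : 'rV[R]_d) :
    'rV[R]_d :=
  \row_(i < d) 'D_(delta_mx 0 i) f x.

Definition strongly_convex_smooth (R : realType) (M : R) (d : nat)
    (f : 'rV[R]_d -> R) : Prop :=
  [/\ forall x, differentiable f x,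
      forall x y, f x + dotv (grad f x) (y - x) + 2^-1 * enorm (y - x) ^+ 2
                  <= f y
    & forall x y, enorm (grad f x - grad f y) <= M * enorm (x - y)].

Definition is_minimizer (R : realType) (d : nat) (f : 'rV[R]_d -> R)
    (xs : 'rV[R]_d) : Prop :=
  forall y, f xs <= f y.

Definition is_oracle (R : realType) (sigma : R) (d : nat)
    (f : 'rV[R]_d -> R) (I : finType) (g : 'rV[R]_d -> I -> 'rV[R]_d) : Prop :=
  [/\ (0 < #|I|)%N,
      forall x, #|I|%:R^-1 *: \sum_(i : I) g x i = grad f x
    & forall x, #|I|%:R^-1 * \sum_(i : I) enorm (g x i - grad f x) ^+ 2
                <= sigma ^+ 2].

Definition sg_step (R : realType) (d : nat) (I : finType)
    (g : 'rV[R]_d -> I -> 'rV[R]_d) (s : R) (x : 'rV[R]_d) (i : I) : 'rV[R]_d :=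
  x - s *: g x i.

Definition terminal_error (R : realType) (d : nat) (I : finType)
    (g : 'rV[R]_d -> I -> 'rV[R]_d) (alpha beta : R) (x0 xs : 'rV[R]_d) : R :=
  (#|I|%:R ^+ 2)^-1 *
  \sum_(p : I * I)
    enorm (sg_step g beta (sg_step g alpha x0 p.1) p.2 - xs) ^+ 2.

(* p = (alpha, beta). The minimizer xs is unique for the f considered here, by
   strong convexity. *)
Definition worst_case_error (R : realType) (M rho sigma : R) (p : R * R) :
    \bar R :=
  ereal_sup [set e : \bar R |
    exists (d : nat) (f : 'rV[R]_d -> R) (x0 xs : 'rV[R]_d)
           (I : finType) (g : 'rV[R]_d -> I -> 'rV[R]_d),
      [/\ (2 <= d)%N /\ strongly_convex_smooth M f,
          is_minimizer f xs,
          enorm (x0 - xs) <= rho,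
          is_oracle sigma f g
        & e = (terminal_error g p.1 p.2 x0 xs)%:E]].

Definition stepsizes (R : realType) : set (R * R) :=
  [set p | 0 <= p.1 /\ 0 <= p.2].

Definition argmin_on (R : realType) (T : Type) (A : set T) (F : T -> \bar R) :
    set T :=
  [set p | A p /\ forall q, A q -> (F p <= F q)%E].

Definition alphabar (R : realType) (M : R) : R := 2 / (M + 1).

Definition etaM (R : realType) (M : R) : R :=
  Num.sqrt (2 * M ^+ 2 - 2 * M + 1).

Definition gamma1 (R : realType) (M : R) : R := 2 / (M - 1).

Definition gamma2 (R : realType) (M : R) : R :=
  2 * (M ^+ 2 + 3) / (M - 1) ^+ 3.

Definition ahat (R : realType) (M : R) : R := (M - 1 + etaM M) / M.

Definition Tfun (R : realType) (M zeta : R) : R :=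
  (M - 1) ^+ 4 * zeta ^+ 2 / ((M * zeta + 1) ^+ 2 * (zeta + M) ^+ 2).

Definition Ufun (R : realType) (M zeta : R) : R :=
  (zeta + 1) ^+ 2 * ((2 * M ^+ 2 - 2 * M + 1) * zeta ^+ 2 + 2 * M * zeta + 1)
  / ((M * zeta + 1) ^+ 2 * (zeta + M) ^+ 2).

Definition gammastar (R : realType) (M : R) : R :=
  (Ufun M (ahat M) - Ufun M 1) / (Tfun M 1 - Tfun M (ahat M)).

(* For M > 1 one has 0 < gamma1 < gamma2 < gammastar, and adjacent formulas
   give the same pair at gamma1 and at gamma2, but not at gammastar, which
   belongs to the last branch. *)
Definition schedule (R : realType) (M gamma : R) : R * R :=
  if gamma <= gamma1 M then (gamma / (1 + gamma), gamma / (1 + 2 * gamma))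
  else if gamma <= gamma2 M then
    (alphabar M,
     (gamma * (M - 1) ^+ 2 + 4) / (gamma * (M - 1) ^+ 2 + 4 + (M + 1) ^+ 2))
  else if gamma < gammastar M then (alphabar M, alphabar M)
  else (2 / (1 + etaM M), 2 / (1 + 2 * M - etaM M)).

Definition V1 (R : realType) (gamma : R) : R := gamma / (1 + 2 * gamma).

Definition V2 (R : realType) (M gamma : R) : R :=
  (gamma * (M - 1) ^+ 2 + 4) / (gamma * (M - 1) ^+ 2 + 4 + (M + 1) ^+ 2).

Definition V3 (R : realType) (M gamma : R) : R :=
  gamma * Tfun M 1 + Ufun M 1.

Definition V4 (R : realType) (M gamma : R) : R :=
  gamma * Tfun M (ahat M) + Ufun M (ahat M).

Definition Vstar (R : realType) (M gamma : R) : R :=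
  if gamma <= gamma1 M then V1 gamma
  else if gamma <= gamma2 M then V2 M gamma
  else if gamma <= gammastar M then V3 M gamma
  else V4 M gamma.

(* Main.v *)
Require Import Defs.
From HB Require Import structures.
From mathcomp Require Import all_boot all_order all_algebra.
From mathcomp Require Import all_classical all_reals all_analysis.
From mathcomp Require Import ring lra.

Set Implicit Arguments.
Unset Strict Implicit.
Unset Printing Implicit Defensive.

Import Order.TTheory GRing.Theory Num.Theory.
Import numFieldNormedType.Exports.

Local Open Scope classical_set_scope.
Local Open Scope ring_scope.

(** Write g for rho^2 / sigma^2 and measure errors in units of sigma^2. The
    theorem holds because the error of the proposed steps has an upper bound
    which is met by three explicit families of hard instances, and because
    these instances alone rule out all other steps.

    Lower bounds. A hard instance is separable in the plane. The start lies on
    the first axis and the noise acts along the second, so that the error is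
    c^2 g + a^2 (1 - b q)^2 + b^2, where c is the contraction along the first
    axis and q the curvature of the second (lemma worst_case_error_hard). The
    contraction comes from a quadratic, from a function with different
    curvatures on the two sides of its minimizer, which the first step jumps
    over, or from a half-Huber function, whose slope is flat at the start but
    whose curvature is M where the second step is taken.

    Upper bounds. If both steps are at most alphabar, each step contracts the
    squared distance by (1 - b)^2 and adds the variance (short_steps_error).
    For the hedged pair of steps used beyond gammastar this is not enough. An
    identity between interpolation inequalities for the minimizer, the start
    and the first iterate gives the deterministic contraction of the two steps
    together; the noise of the first step is controlled separately, by the
    covariance form of cocoercivity (hedged_mean_error).

    Optimization over the steps (a, b). Completing squares in the bounds from
    the quadratic of curvature 1 and from the overshooting function gives the
    result up to gamma2. Beyond it, these bounds and the quadratic of curvature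
    M show that equal steps are the best ones, except among those with
    a < alphabar < b. There all bounds are affine in g, so it suffices to
    compare at gamma2 and at gammastar, and to compare slopes beyond gammastar
    (quadrant_le_V3, quadrant_le_V4). At gammastar, each pair of steps is
    reduced to one on the curve 1/a + 1/b = M + 1, where the quadratics of
    curvature 1 and M contract equally: below the curve the first step is
    lengthened, above it the second step is shortened, and for first steps
    shorter and second steps longer than the hedged ones the half-Huber
    function takes over. The points of the curve with parameter t have error
    g T(t) + U(t), and above_chord states that, at gammastar, this exceeds its
    common value at the two ends t = 1 (equal steps) and t = ahat (hedged
    steps). *)

Ltac le_by_eq := rewrite le_eqVlt; apply/orP; left; apply/eqP.

(* Syntactic matching: unification would try to compute large literals. *)
Ltac nonneg := repeat match goal with
  | H : ?P |- ?P => exact: H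
  | H : is_true (0 < ?x) |- is_true (0 <= ?x) => exact: (ltW H)
  | |- is_true (0 <= _%:R) => exact: ler0n
  | |- is_true (0 <= 1) => exact: ler01
  | |- is_true (0 <= _ + _) => apply: addr_ge0
  | |- is_true (0 <= _ * _) => apply: mulr_ge0
  | |- is_true (0 <= _ ^+ _) => apply: exprn_ge0
  end.

Ltac positive := repeat match goal with
  | H : ?P |- ?P => exact: H
  | |- is_true (0 < _ * _) => apply: mulr_gt0
  | |- is_true (0 < _ ^+ _) => apply: exprn_gt0
  end.

(** * Euclidean geometry of row vectors *)

Section Dot.
Context (R : realType) (d : nat).
Implicit Types (u v w : 'rV[R]_d) (k : R).

Lemma dotvC u v : dotv u v = dotv v u.
Proof. by apply: eq_bigr => i _; rewrite mulrC. Qed.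

Lemma dotvDl u v w : dotv (u + v) w = dotv u w + dotv v w.
Proof. by rewrite /dotv -big_split; apply: eq_bigr => i _; rewrite mxE mulrDl. Qed.

Lemma dotvZl k u w : dotv (k *: u) w = k * dotv u w.
Proof. by rewrite /dotv mulr_sumr; apply: eq_bigr => i _; rewrite mxE mulrA. Qed.

Lemma dotvNl u w : dotv (- u) w = - dotv u w.
Proof. by rewrite -scaleN1r dotvZl mulN1r. Qed.

Lemma dotvDr u v w : dotv w (u + v) = dotv w u + dotv w v.
Proof. by rewrite dotvC dotvDl !(dotvC w). Qed.

Lemma dotvZr k u w : dotv w (k *: u) = k * dotv w u.
Proof. by rewrite dotvC dotvZl (dotvC w). Qed.

Lemma dotvNr u w : dotv w (- u) = - dotv w u.
Proof. by rewrite dotvC dotvNl (dotvC w). Qed.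

Lemma dotv0r w : dotv w 0 = 0.
Proof. by rewrite -[X in dotv _ X](scale0r 0) dotvZr mul0r. Qed.

Lemma dotv0l w : dotv 0 w = 0.
Proof. by rewrite dotvC dotv0r. Qed.

Definition dotvE := (dotvDl, dotvDr, dotvNl, dotvNr, dotvZl, dotvZr).

Lemma dotv_ge0 u : 0 <= dotv u u.
Proof. by apply: sumr_ge0 => i _; rewrite -expr2 sqr_ge0. Qed.

Lemma dotv_eq0 u : dotv u u = 0 -> u = 0.
Proof.
move=> /eqP; rewrite psumr_eq0 => [/allP u0|i _]; last by rewrite -expr2 sqr_ge0.
apply/rowP => i; rewrite mxE; apply/eqP.
by have := u0 i (mem_index_enum _); rewrite -expr2 sqrf_eq0.
Qed.

Lemma enorm_ge0 u : 0 <= enorm u.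
Proof. exact: sqrtr_ge0. Qed.

Lemma enorm_sqr u : enorm u ^+ 2 = dotv u u.
Proof. by rewrite /enorm sqr_sqrtr // dotv_ge0. Qed.

Lemma enormZ k u : enorm (k *: u) = `|k| * enorm u.
Proof.
by rewrite /enorm !dotvE mulrA -expr2 sqrtrM ?sqr_ge0 // sqrtr_sqr.
Qed.

Lemma cauchy_schwarz u v : dotv u v <= enorm u * enorm v.
Proof.
have [->|v0] := eqVneq v 0.
  by rewrite dotv0r mulr_ge0 ?enorm_ge0.
have vv : 0 < dotv v v.
  by rewrite lt_neqAle dotv_ge0 andbT eq_sym; apply/eqP => /dotv_eq0 /eqP; rewrite (negbTE v0).
suff h : dotv u v ^+ 2 <= dotv u u * dotv v v.
  rewrite /enorm -sqrtrM ?dotv_ge0 //; apply: le_trans (ler_norm _) _.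
  by rewrite -sqrtr_sqr ler_sqrt // mulr_ge0 ?dotv_ge0.
have := dotv_ge0 (dotv v v *: u - dotv u v *: v).
rewrite !dotvE (dotvC v u) => h; rewrite -subr_ge0 -(pmulr_rge0 _ vv).
by apply: le_trans h _; le_by_eq; ring.
Qed.

End Dot.

(** * Gradients and the descent lemma *)

Lemma diff_of_remainder (R : numFieldType) (V W : normedModType R) (f : V -> W)
    (L : {linear V -> W}) (x : V) : continuous L ->
  (forall e : R, 0 < e ->
    \forall h \near nbhs (0 : V), `|f (h + x) - f x - L h| <= e * `|h|) ->
  differentiable f x /\ 'd f x = L :> (V -> W).
Proof.
move=> Lc Lf.
have fL : f \o shift x = cst (f x) + L +o_ (0 : V) id.
  apply/eqaddoP => e e0; near=> h; rewrite !fctE /= opprD addrA.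
  by near: h; exact: Lf.
have dfL := diff_unique Lc fL.
by split=> //; apply/diff_locallyP; rewrite dfL.
Unshelve. all: by end_near. Qed.

Section Gradient.
Context (R : realType) (d : nat).
Implicit Types (f : 'rV[R]_d -> R) (x y v g : 'rV[R]_d).

Lemma dotv_grad f x v : differentiable f x -> 'D_v f x = dotv (grad f x) v.
Proof.
move=> df; rewrite deriveE // {1}(row_sum_delta v) linear_sum /=.
by apply: eq_bigr => i _; rewrite linearZ mxE deriveE // mulrC.
Qed.

Lemma dotv_le_norm v : dotv v v <= d%:R * `|v| ^+ 2.
Proof.
rewrite -[d in d%:R]card_ord mulr_natl -sumr_const; apply: ler_sum => i _.
rewrite -expr2 -real_normK ?num_real // lerXn2r ?nnegrE //.
rewrite [leRHS]/Num.norm /= mx_normrE.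
exact: (le_trans _ (le_bigmax _ _ (0, i))).
Qed.

(** The remainder is of second order, hence negligible, whatever the norm:
    this computes the gradient of a function from a quadratic estimate,
    without any differentiation rule. *)
Lemma grad_of_quadratic_bound f x g (K : R) :
  (forall y, `|f y - f x - dotv g (y - x)| <= K * dotv (y - x) (y - x)) ->
  differentiable f x /\ grad f x = g.
Proof.
move=> fK.
have lin : linear (dotv g) by move=> a u v; rewrite dotvDr dotvZr.
pose L : {linear 'rV[R]_d -> R} :=
  HB.pack (dotv g) (GRing.isLinear.Build _ _ _ _ (dotv g) lin).
have Lc : continuous L.
  rewrite /= /dotv; elim: (index_enum _) => [|i r IHr] y.
    under eq_fun do rewrite big_nil.
    exact: cst_continuous.
  under eq_fun do rewrite big_cons.
  suff : {for y, continuous ((fun v => g 0 i * v 0 i) +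
      (fun v => \sum_(j <- r) g 0 j * v 0 j))} by [].
  apply: continuousD; last exact: IHr.
  apply: (@continuousM _ _ (cst (g 0 i)) (fun v => v 0 i)).
    exact: cst_continuous.
  exact: coord_continuous.
have [|df dL] := @diff_of_remainder R _ _ f L x Lc.
  move=> e e0.
  have K0 : 0 < `|K| * d%:R + 1 by rewrite ltr_wpDl // mulr_ge0.
  near=> h.
  have := fK (h + x); rewrite addrK => /le_trans; apply.
  have h1 : `|h| <= e / (`|K| * d%:R + 1).
    near: h; apply: (@nbhs0_le R [the normedModType R of ('rV[R]_d)%type]); exact: divr_gt0.
  have : K * dotv h h <= `|K| * (d%:R * `|h| ^+ 2).
    apply: le_trans (ler_wpM2l (normr_ge0 _) (dotv_le_norm h)).
    by rewrite ler_wpM2r ?dotv_ge0 // ler_norm.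
  move=> /le_trans; apply; rewrite expr2 !mulrA ler_wpM2r //.
  move: h1; rewrite ler_pdivlMr // => /(le_trans _); apply.
  by rewrite mulrC ler_wpM2l // lerDl.
split=> //; apply/rowP => i; rewrite mxE deriveE // dL /=.
rewrite /dotv (bigD1 i) //= mxE !eqxx mulr1 big1 ?addr0 // => j ji.
by rewrite mxE (negbTE ji) andbF mulr0.
Unshelve. all: by end_near. Qed.

(** Along a segment, the derivative of the gap between the two sides has
    constant sign, by the Lipschitz bound on the gradient. *)
Lemma descent_lemma f (M : R) : (forall x, differentiable f x) ->
  (forall x y, enorm (grad f x - grad f y) <= M * enorm (x - y)) ->
  forall x y, f y <= f x + dotv (grad f x) (y - x) + M / 2 * dotv (y - x) (y - x).
Proof.
move=> df fM x y; set v := y - x.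
pose p (t : R) := f (x + t *: v).
pose q (t : R) := t * dotv (grad f x) v + t ^+ 2 * (M / 2 * dotv v v).
have dp (t : R) : is_derive t 1 p (dotv (grad f (x + t *: v)) v).
  have E : (fun h : R => h^-1 *: ((p \o shift t) (h *: 1) - p t)) =
      (fun h => h^-1 *: ((f \o shift (x + t *: v)) (h *: v) - f (x + t *: v))).
    apply/funext => h /=; rewrite /p; congr (_ *: (f _ - _)).
    by rewrite [h *: 1]mulr1 scalerDl addrCA.
  split; first by rewrite /derivable E; exact: diff_derivable.
  by rewrite -dotv_grad // /derive E.
have dq (t : R) : is_derive t 1 q (dotv (grad f x) v + t * (M * dotv v v)).
  rewrite /q; apply: is_derive_eq.
  rewrite /GRing.scale /=. by field.
have dpq (t : R) : is_derive t 1 (p - q) (dotv (grad f (x + t *: v)) v -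
    (dotv (grad f x) v + t * (M * dotv v v))) by exact: is_deriveB.
have le10 : (p - q) 1 <= (p - q) 0.
  apply: (@ler0_derive1_nincr _ (p - q) 0 1) => //.
  - move=> t; rewrite in_itv /= => /andP[t0 t1].
    rewrite derive1E (@derive_val _ _ _ _ _ _ _ (dpq t)) opprD addrA subr_le0.
    rewrite -dotvNl -dotvDl.
    apply: le_trans (cauchy_schwarz _ _) _.
    have := fM (x + t *: v) x; rewrite [x + _]addrC addrK enormZ gtr0_norm // => h.
    apply: le_trans (ler_wpM2r (enorm_ge0 _) h) _.
    by rewrite -enorm_sqr; le_by_eq; ring.
  - apply: continuous_subspaceT => t; apply: differentiable_continuous.
    by apply/derivable1_diffP.
have -> : y = x + 1 *: v by rewrite scale1r addrC subrK.
move: le10; rewrite /p /q !fctE /= scale0r addr0 expr0n /= expr1n. lra.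
Qed.

End Gradient.

(** * Interpolation inequalities *)

Section Interpolation.
Context (R : realType) (M : R) (d : nat) (f : 'rV[R]_d -> R) (xs : 'rV[R]_d).
Hypotheses (M1 : 1 < M) (fM : strongly_convex_smooth M f).
Hypothesis xsmin : is_minimizer f xs.
Implicit Types x y : 'rV[R]_d.

(** Subtracting the quadratic of curvature 1 centred at the minimizer turns a
    1-strongly convex, M-smooth function into a convex, (M-1)-smooth one, the
    excess, whose gradient is the residual. *)
Definition residual x := grad f x - (x - xs).
Definition excess x := f x - dotv (x - xs) (x - xs) / 2.

(** Otherwise a gradient step of length 1/M would decrease f, by the descent
    lemma. *)
Lemma grad_minimizer : grad f xs = 0.
Proof.
have [df _ Lf] := fM; have M0 : 0 < M by apply: lt_trans M1.
have := descent_lemma df Lf xs (xs - M^-1 *: grad f xs).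
rewrite [_ - xs]addrAC subrr add0r !dotvE => h.
have := le_trans (xsmin _) h => {}h.
apply: dotv_eq0; apply/eqP; rewrite eq_le dotv_ge0 andbT.
have : 0 <= - (dotv (grad f xs) (grad f xs) / (2 * M)).
  rewrite -(lerD2l (f xs)) addr0; apply: le_trans h _.
  by le_by_eq; field; rewrite ?gt_eqF.
by rewrite oppr_ge0 pmulr_lle0 // invr_gt0 mulr_gt0.
Qed.

Lemma residual_minimizer : residual xs = 0.
Proof. by rewrite /residual grad_minimizer subrr subr0. Qed.

(** Minimise over z the gap between the quadratic upper bound of f at y and its
    quadratic lower bound at x; the best z is y minus a step of length 1/(M-1)
    along the difference of the residual gradients. *)
Lemma residual_interpolation x y :
  dotv (residual x) (y - x) +
    dotv (residual y - residual x) (residual y - residual x) / (2 * (M - 1))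
  <= excess y - excess x.
Proof.
have [df sc Lf] := fM; have M0 : 0 < M - 1 by rewrite subr_gt0.
pose w := residual y - residual x.
have gy : grad f y = grad f x + (y - x) + w.
  rewrite /w /residual; apply/rowP => i; rewrite !mxE; ring.
set z := y - (M - 1)^-1 *: w.
have := le_trans (sc x z) (descent_lemma df Lf y z).
rewrite enorm_sqr -/w.
have -> : z - x = (y - x) - (M - 1)^-1 *: w by rewrite /z addrAC.
have -> : z - y = - ((M - 1)^-1 *: w) by rewrite /z addrC addKr.
rewrite gy /excess.
have -> : y - xs = (x - xs) + (y - x) by rewrite [RHS]addrC subrKA.
rewrite {gy z} -/w /residual; move: w (y - x) (x - xs) => w e u.
rewrite !dotvE (dotvC w e) (dotvC u e) => h.
rewrite -subr_ge0; move: h; rewrite -subr_ge0 => /le_trans; apply.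
by le_by_eq; field; rewrite ?gt_eqF.
Qed.

(** The sum of the interpolation inequalities for (x, y) and for (y, x), in
    which the function values cancel. *)
Lemma residual_cocoercive x y :
  dotv (residual x - residual y) (residual x - residual y) / (M - 1)
  <= dotv (residual x - residual y) (x - y).
Proof.
have M0 : 0 < M - 1 by rewrite subr_gt0.
have h1 := residual_interpolation x y; have h2 := residual_interpolation y x.
have := lerD h1 h2; rewrite -(opprB x y) -(opprB (residual x)) !dotvE.
rewrite -subr_ge0 => h.
rewrite -subr_ge0; apply: le_trans h _.
by le_by_eq; field; rewrite ?gt_eqF.
Qed.

(** Steps up to 2/(M+1) are those for which the curvature 1 contracts the
    least; cocoercivity of the residual then absorbs its squared norm. *)
Lemma gradient_step_contraction b x : 0 <= b -> b <= 2 / (M + 1) ->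
  dotv (x - xs - b *: grad f x) (x - xs - b *: grad f x)
  <= (1 - b) ^+ 2 * dotv (x - xs) (x - xs).
Proof.
have M0 : 0 < M - 1 by rewrite subr_gt0.
move=> b0; rewrite ler_pdivlMr; last by lra.
move=> bM; have := residual_cocoercive x xs; rewrite residual_minimizer subr0.
have -> : grad f x = residual x + (x - xs) by rewrite /residual subrK.
move: (residual x) (x - xs) => s u.
rewrite ler_pdivrMr; last by lra.
rewrite !dotvE (dotvC u s) => h.
have : 0 <= b * ((1 - b) * (2 * (dotv s u * (M - 1) - dotv s s)) +
                 (2 - b * (M + 1)) * dotv s s).
  by rewrite mulr_ge0 // addr_ge0 // mulr_ge0 ?dotv_ge0 //; nra.
move=> k; rewrite -(ler_pM2r M0) -subr_ge0; apply: le_trans k _.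
by le_by_eq; ring.
Qed.

End Interpolation.

(** * Averages and short steps *)

Section Average.
Context (R : realType) (I : finType).
Implicit Types (F G : I -> R).

Definition avg F : R := #|I|%:R^-1 * \sum_i F i.

Lemma avgD F G : avg (fun i => F i + G i) = avg F + avg G.
Proof. by rewrite /avg big_split mulrDr. Qed.

Lemma avgZ k F : avg (fun i => k * F i) = k * avg F.
Proof. by rewrite /avg -mulr_sumr mulrCA. Qed.

Lemma avgN F : avg (fun i => - F i) = - avg F.
Proof. by rewrite /avg sumrN mulrN. Qed.

Lemma avg_cst k : (0 < #|I|)%N -> avg (fun=> k) = k.
Proof. by move=> I0; rewrite /avg sumr_const -[k *+ _]mulr_natl mulKf // pnatr_eq0 -lt0n. Qed.

Lemma le_avg F G : (forall i, F i <= G i) -> avg F <= avg G.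
Proof. by move=> FG; rewrite ler_wpM2l ?invr_ge0 // ler_sum. Qed.

Lemma avg_ge0 F : (forall i, 0 <= F i) -> 0 <= avg F.
Proof. by move=> F0; rewrite mulr_ge0 ?invr_ge0 // sumr_ge0. Qed.

Lemma eq_avg F G : (forall i, F i = G i) -> avg F = avg G.
Proof. by move=> FG; rewrite /avg (eq_bigr _ (fun i _ => FG i)). Qed.

Context (d : nat).
Implicit Types (X Y : I -> 'rV[R]_d).

Definition avgv X : 'rV[R]_d := #|I|%:R^-1 *: \sum_i X i.

Lemma avg_dotvl X v : avg (fun i => dotv (X i) v) = dotv (avgv X) v.
Proof.
rewrite dotvZl; congr (_ * _).
elim/big_rec2: _ => [|i u w _ IHr]; last by rewrite dotvDl IHr.
by rewrite dotvC dotv0r.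
Qed.

Lemma avg_dotvr X v : avg (fun i => dotv v (X i)) = dotv v (avgv X).
Proof. by rewrite dotvC -avg_dotvl; apply: eq_avg => i; rewrite dotvC. Qed.

Hypothesis I0 : (0 < #|I|)%N.

Lemma avgv_centered (X : I -> 'rV[R]_d) v : avgv X = v ->
  avgv (fun i => X i - v) = 0.
Proof.
rewrite /avgv sumrB scalerBr => ->.
by rewrite sumr_const -[v *+ _]scaler_nat scalerA mulVf ?scale1r ?subrr // pnatr_eq0 -lt0n.
Qed.

Lemma bias_variance v w X k : avgv X = w ->
  avg (fun i => dotv (v - k *: X i) (v - k *: X i)) =
  dotv (v - k *: w) (v - k *: w) + k ^+ 2 * avg (fun i => dotv (X i - w) (X i - w)).
Proof.
move=> /avgv_centered Xw.
have E i : dotv (v - k *: X i) (v - k *: X i) = dotv (v - k *: w) (v - k *: w) +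
   (- 2 * k * dotv (v - k *: w) (X i - w) + k ^+ 2 * dotv (X i - w) (X i - w)).
  have -> : v - k *: X i = (v - k *: w) - k *: (X i - w).
    by rewrite scalerBr opprB addrA subrK.
  move: (v - _) (X i - w) => a b.
  by rewrite !dotvE (dotvC b a); ring.
rewrite (eq_avg E) !(avgD, avgZ) avg_cst // avg_dotvr Xw dotv0r.
ring.
Qed.

(** Average the cocoercivity inequality over all pairs of indices. *)
Lemma covariance_cocoercive X Y k :
  (forall i j, k * dotv (Y i - Y j) (Y i - Y j) <= dotv (Y i - Y j) (X i - X j)) ->
  k * (avg (fun i => dotv (Y i) (Y i)) - dotv (avgv Y) (avgv Y)) <=
  avg (fun i => dotv (Y i) (X i)) - dotv (avgv Y) (avgv X).
Proof.
move=> h.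
have : avg (fun i => avg (fun j => k * dotv (Y i - Y j) (Y i - Y j))) <=
       avg (fun i => avg (fun j => dotv (Y i - Y j) (X i - X j))).
  by apply: le_avg => i; apply: le_avg.
have E (Z W : I -> 'rV[R]_d) : avg (fun i => avg (fun j => dotv (Z i - Z j) (W i - W j))) =
    2 * (avg (fun i => dotv (Z i) (W i)) - dotv (avgv Z) (avgv W)).
  under eq_avg => i.
    under eq_avg => j do rewrite !dotvE opprK.
    rewrite !(avgD, avgN) avg_cst // avg_dotvl avg_dotvr.
  over.
  rewrite !(avgD, avgN) avg_cst // avg_dotvl avg_dotvr.
  ring.
under eq_avg => i do rewrite avgZ.
by rewrite avgZ !E mulrCA ler_pM2l.
Qed.

End Average.

Lemma terminal_error_avg (R : realType) (d : nat) (I : finType)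
    (g : 'rV[R]_d -> I -> 'rV[R]_d) (a b : R) (x0 xs : 'rV[R]_d) :
  terminal_error g a b x0 xs =
  avg (fun i => avg (fun j => dotv (sg_step g a x0 i - xs - b *: g (sg_step g a x0 i) j)
                                   (sg_step g a x0 i - xs - b *: g (sg_step g a x0 i) j))).
Proof.
rewrite /terminal_error /avg -mulr_sumr mulrA -invfM -expr2; congr (_ * _).
rewrite pair_big /=; apply: eq_bigr => -[i j] _ /=.
by rewrite enorm_sqr /sg_step addrAC.
Qed.

Section UpperBound.
Context (R : realType) (M rho sigma : R) (d : nat) (f : 'rV[R]_d -> R).
Context (x0 xs : 'rV[R]_d) (I : finType) (g : 'rV[R]_d -> I -> 'rV[R]_d).
Hypotheses (M1 : 1 < M) (fM : strongly_convex_smooth M f).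
Hypotheses (xsmin : is_minimizer f xs) (x0rho : enorm (x0 - xs) <= rho).
Hypothesis gor : is_oracle sigma f g.
Variables (a b : R).

Let X i := sg_step g a x0 i - xs.
Let Gr i := grad f (sg_step g a x0 i).

Lemma step_variance k x v :
  avg (fun j => dotv (v - k *: g x j) (v - k *: g x j)) <=
  dotv (v - k *: grad f x) (v - k *: grad f x) + k ^+ 2 * sigma ^+ 2.
Proof.
have [I0 mg vg] := gor; rewrite (bias_variance I0 _ _ (mg x)) lerD2l.
apply: ler_wpM2l; first exact: sqr_ge0.
apply: le_trans (vg x); rewrite /avg; le_by_eq.
by congr (_ * _); apply: eq_bigr => i _; rewrite enorm_sqr.
Qed.

(** The noise of the second step is independent of the first iterate, so that
    it only adds its variance. *)
Lemma terminal_error_le :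
  terminal_error g a b x0 xs <=
  avg (fun i => dotv (X i - b *: Gr i) (X i - b *: Gr i)) + b ^+ 2 * sigma ^+ 2.
Proof.
have [I0 _ _] := gor; rewrite terminal_error_avg -[b ^+ 2 * _](@avg_cst _ _ _ I0) -avgD.
by apply: le_avg => i; exact: step_variance.
Qed.

Lemma dist0_le : dotv (x0 - xs) (x0 - xs) <= rho ^+ 2.
Proof.
rewrite -enorm_sqr lerXn2r // ?nnegrE ?enorm_ge0 //.
exact: le_trans (enorm_ge0 _) x0rho.
Qed.

Lemma short_steps_error : 0 <= a -> a <= 2 / (M + 1) -> 0 <= b -> b <= 2 / (M + 1) ->
  terminal_error g a b x0 xs <=
  (1 - b) ^+ 2 * ((1 - a) ^+ 2 * rho ^+ 2 + a ^+ 2 * sigma ^+ 2) + b ^+ 2 * sigma ^+ 2.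
Proof.
move=> a0 aM b0 bM; apply: le_trans terminal_error_le _; rewrite lerD2r.
have := le_avg (fun i => gradient_step_contraction M1 fM xsmin (sg_step g a x0 i) b0 bM).
move=> /le_trans; apply; rewrite avgZ ler_wpM2l ?sqr_ge0 //.
rewrite (@eq_avg _ _ _ (fun i => dotv (x0 - xs - a *: g x0 i) (x0 - xs - a *: g x0 i))).
  apply: le_trans (step_variance _ _ _) _; rewrite lerD2r.
  apply: le_trans (gradient_step_contraction M1 fM xsmin x0 a0 aM) _.
  by rewrite ler_wpM2l ?sqr_ge0 // dist0_le.
by move=> i; rewrite /sg_step addrAC.
Qed.

End UpperBound.

(** * Hedged steps *)

Section HedgedUpperBound.
Context (R : realType) (M rho sigma : R) (d : nat) (f : 'rV[R]_d -> R).
Context (x0 xs : 'rV[R]_d) (I : finType) (g : 'rV[R]_d -> I -> 'rV[R]_d).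
Hypotheses (M1 : 1 < M) (fM : strongly_convex_smooth M f).
Hypotheses (xsmin : is_minimizer f xs) (x0rho : enorm (x0 - xs) <= rho).
Hypothesis gor : is_oracle sigma f g.
Context (a b : R).

(** Multipliers of the interpolation inequalities from the minimizer to x0
    (ls0) and to x1 (ls1), from x0 to x1 (l01) and from x1 to x0 (l10); the
    one from x1 to the minimizer gets ls0 + ls1. The flow equations make the
    function values cancel. The others make the Gram matrix of the
    deterministic certificate vanish; each is named after the coefficient
    that it kills, u0 being x0 - xs, and s0, s1 the residuals at x0, x1. *)
Context (ls0 ls1 l01 l10 : R).
Hypotheses (ls0_ge0 : 0 <= ls0) (ls1_ge0 : 0 <= ls1).
Hypotheses (l01_ge0 : 0 <= l01) (l10_ge0 : 0 <= l10).
Hypothesis flow0 : l01 = ls0 + l10.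
Hypothesis flow1 : ls1 + l01 = b ^+ 2 * (M - 1).
Hypothesis coef_u0s0 : ls0 + l10 * a = 2 * (1 - a) * (1 - b) ^+ 2 * a.
Hypothesis coef_s0s0 : l01 = (M - 1) * (l10 * a + (1 - b) ^+ 2 * a ^+ 2).
Hypothesis coef_s0s1 : l01 + l10 = (M - 1) * (a * (b ^+ 2 * (M - 1)) - 2 * (1 - b) * a * b).
Hypothesis coef_u0s1 : ls1 * (1 - a) - l01 * a = 2 * (1 - a) * (1 - b) * b.

Let S := residual f xs.

(** The weighted sum of five interpolation inequalities, with no square left
    over. The terms in y are those of a first iterate displaced by noise; the
    one pairing y with a fixed vector disappears on average. *)
Lemma hedged_certificate x1 y : x1 - xs = (1 - a) *: (x0 - xs) - a *: S x0 + y ->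
  dotv (x1 - xs - b *: grad f x1) (x1 - xs - b *: grad f x1) <=
  ((1 - a) * (1 - b)) ^+ 2 * dotv (x0 - xs) (x0 - xs)
  + dotv (2 * (1 - b) ^+ 2 *: ((1 - a) *: (x0 - xs) - a *: S x0) - l10 *: S x0) y
  + (1 - b) ^+ 2 * dotv y y
  + (b ^+ 2 * (M - 1) - 2 * (1 - b) * b) * dotv (S x1) y.
Proof.
move=> x1E.
have L0 : M - 1 != 0 by rewrite gt_eqF // subr_gt0.
have i_s0 := ler_wpM2l ls0_ge0 (@residual_interpolation R M d f xs M1 fM x0 xs).
have i_s1 := ler_wpM2l ls1_ge0 (@residual_interpolation R M d f xs M1 fM x1 xs).
have i_01 := ler_wpM2l l01_ge0 (@residual_interpolation R M d f xs M1 fM x1 x0).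
have i_10 := ler_wpM2l l10_ge0 (@residual_interpolation R M d f xs M1 fM x0 x1).
have e_ge0 : 0 <= ls0 + ls1 by exact: addr_ge0.
have i_1s := ler_wpM2l e_ge0 (@residual_interpolation R M d f xs M1 fM xs x1).
move: i_s0 i_s1 i_01 i_10 i_1s; rewrite (@residual_minimizer R M d f xs M1 fM xsmin) -/S.
have -> : grad f x1 = S x1 + (x1 - xs) by rewrite /S /residual subrK.
have -> : x0 - x1 = (x0 - xs) - (x1 - xs) by rewrite opprB addrA subrK.
have -> : x1 - x0 = (x1 - xs) - (x0 - xs) by rewrite opprB addrA subrK.
rewrite -(opprB x0 xs) -(opprB x1 xs) x1E.
move: (x0 - xs) (S x0) (S x1) (excess f xs xs) (excess f xs x0) (excess f xs x1) => u s t hs h0 h1.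
rewrite !sub0r !subr0 !dotv0l !dotvE.
rewrite !(dotvC s u) !(dotvC t u) !(dotvC t s) !(dotvC y u) !(dotvC y s) !(dotvC y t).
move: (dotv u u) (dotv u s) (dotv s s) (dotv u t) (dotv s t) (dotv t t) (dotv u y)
  (dotv s y) (dotv t y) (dotv y y) => uu us ss ut st tt uy sy ty yy i1 i2 i3 i4 i5.
have := lerD i1 (lerD i2 (lerD i3 (lerD i4 i5))).
rewrite -subr_ge0 => key; rewrite -subr_ge0; apply: le_trans key _.
rewrite le_eqVlt; apply/orP; left; rewrite -subr_eq0; apply/eqP.
have ls1E : ls1 = b ^+ 2 * (M - 1) - (ls0 + l10) by rewrite -flow0 -flow1 addrK.
move: coef_u0s0 coef_s0s0 coef_s0s1 coef_u0s1; rewrite ls1E flow0.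
move=> /eqP; rewrite -subr_eq0 => /eqP c1 /eqP; rewrite -subr_eq0 => /eqP c2.
move=> /eqP; rewrite -subr_eq0 => /eqP c3 /eqP; rewrite -subr_eq0 => /eqP c4.
transitivity ((ls0 + l10 * a - 2 * (1 - a) * (1 - b) ^+ 2 * a) * us
  - (ls0 + l10 - (M - 1) * (l10 * a + (1 - b) ^+ 2 * a ^+ 2)) * ss / (M - 1)
  + (ls0 + l10 + l10 - (M - 1) * (a * (b ^+ 2 * (M - 1)) - 2 * (1 - b) * a * b)) * st / (M - 1)
  + ((b ^+ 2 * (M - 1) - (ls0 + l10)) * (1 - a) - (ls0 + l10) * a
     - 2 * (1 - a) * (1 - b) * b) * ut).
  by field.
by rewrite c1 c2 c3 c4 !mul0r subr0 !addr0.
Qed.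

(** The certificate leaves no slack on the mean trajectory, so that the noise
    has to be paid for by one more inequality: cocoercivity between the noisy
    copies of the first iterate, in covariance form. What then remains is the
    variance of the residual minus M - 1 times the displacement y, which is
    nonnegative and vanishes when the noise sees the curvature M. *)
Lemma hedged_mean_error : 2 <= b * (M + 1) -> 0 <= b ->
  avg (fun i => dotv (sg_step g a x0 i - xs - b *: grad f (sg_step g a x0 i))
                     (sg_step g a x0 i - xs - b *: grad f (sg_step g a x0 i))) <=
  ((1 - a) * (1 - b)) ^+ 2 * rho ^+ 2 + (M * b - 1) ^+ 2 * (a ^+ 2 * sigma ^+ 2).
Proof.
move=> bM b0; have [I0 mg vg] := gor.
have L0 : 0 < M - 1 by rewrite subr_gt0.
pose y i := a *: (grad f x0 - g x0 i); pose t i := S (sg_step g a x0 i).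
have xE i : sg_step g a x0 i - xs = (1 - a) *: (x0 - xs) - a *: S x0 + y i.
  by apply/rowP => k; rewrite /sg_step /y /S /residual !mxE; ring.
have y0 : avgv y = 0.
  rewrite /avgv -scaler_sumr scalerA mulrC -scalerA.
  have := avgv_centered I0 (mg x0); rewrite /avgv => h.
  rewrite -[RHS](scaler0 _ (- a)) -[in RHS]h !scaleNr -scalerN -scalerN -sumrN.
  by congr (_ *: (_ *: _)); apply: eq_bigr => i _; rewrite opprB.
have yvar : avg (fun i => dotv (y i) (y i)) <= a ^+ 2 * sigma ^+ 2.
  apply: le_trans (ler_wpM2l (sqr_ge0 a) (vg x0)).
  rewrite -[leRHS]avgZ; apply: le_avg => i.
  rewrite enorm_sqr /y -opprB scalerN dotvNl dotvNr opprK !dotvE.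
  by le_by_eq; ring.
have := le_avg (fun i => hedged_certificate (xE i)).
move=> /le_trans; apply.
rewrite !(avgD, avgZ) !avg_cst // avg_dotvr y0 dotv0r addr0.
have cov : (M - 1)^-1 * (avg (fun i => dotv (t i) (t i)) - dotv (avgv t) (avgv t)) <=
    avg (fun i => dotv (t i) (y i)).
  have := @covariance_cocoercive R I d I0 y t (M - 1)^-1; rewrite y0 dotv0r subr0.
  apply=> i j.
  have -> : y i - y j = sg_step g a x0 i - sg_step g a x0 j.
    by rewrite /sg_step /y -scalerBr; apply/rowP => k; rewrite !mxE; ring.
  by rewrite mulrC; exact: residual_cocoercive.
have dev : 0 <= avg (fun i => dotv (t i - avgv t - (M - 1) *: y i)
                                   (t i - avgv t - (M - 1) *: y i)).
  by apply: avg_ge0 => i; exact: dotv_ge0.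
have {}dev : 0 <= (avg (fun i => dotv (t i) (t i)) - dotv (avgv t) (avgv t))
    - 2 * (M - 1) * avg (fun i => dotv (t i) (y i))
    + (M - 1) ^+ 2 * avg (fun i => dotv (y i) (y i)).
  have E i : dotv (t i - avgv t - (M - 1) *: y i) (t i - avgv t - (M - 1) *: y i) =
      dotv (t i) (t i) + (- 2) * dotv (t i) (avgv t) + dotv (avgv t) (avgv t)
      + (- (2 * (M - 1))) * dotv (t i) (y i) + 2 * (M - 1) * dotv (avgv t) (y i)
      + (M - 1) ^+ 2 * dotv (y i) (y i).
    move: (t i) (avgv t) (y i) => p q r.
    by rewrite !dotvE (dotvC q p) (dotvC r p) (dotvC r q); ring.
  rewrite (eq_avg E) !(avgD, avgZ) !avg_cst // avg_dotvl avg_dotvr y0 dotv0r in dev.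
  by apply: le_trans dev _; le_by_eq; ring.
have T0 : ((1 - a) * (1 - b)) ^+ 2 * dotv (x0 - xs) (x0 - xs) <=
          ((1 - a) * (1 - b)) ^+ 2 * rho ^+ 2.
  by apply: ler_wpM2l (dist0_le x0rho); exact: sqr_ge0.
rewrite -addrA; apply: lerD T0 _.
apply: le_trans (ler_wpM2l (sqr_ge0 _) yvar).
rewrite mulrC ler_pdivrMr // in cov.
move: cov dev; rewrite -/(t _).
under [X in _ + _ * X <= _]eq_avg => i do rewrite -/(t i).
move: (avg (fun i => dotv (t i) (y i))) (avg (fun i => dotv (y i) (y i))) => C Y.
move: (_ - dotv (avgv t) (avgv t)) => Q cov dev.
have CY : C <= (M - 1) * Y by rewrite -(ler_pM2l L0); nra.
rewrite -subr_ge0.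
have -> : (M * b - 1) ^+ 2 * Y - ((1 - b) ^+ 2 * Y + (b ^+ 2 * (M - 1) - 2 * (1 - b) * b) * C)
  = b * (b * (M + 1) - 2) * ((M - 1) * Y - C) by ring.
by rewrite !mulr_ge0 // subr_ge0.
Qed.

End HedgedUpperBound.

(** The relation selects the point z of the curve (curve_a, curve_b below) at
    which the half-Huber instance contracts exactly as the two quadratics do.
    Solving it for M makes all quantities at that point rational in z. *)
Lemma hedging_curvature (R : realType) (M z : R) :
  1 < M -> 1 < z -> M * z ^+ 2 = (2 * M - 2) * z + M ->
  0 < 1 + 2 * z - z ^+ 2 /\ M = 2 * z / (1 + 2 * z - z ^+ 2).
Proof.
move=> M1 z1 zM; have MD : M * (1 + 2 * z - z ^+ 2) = 2 * z by lra.
have D0 : 0 < 1 + 2 * z - z ^+ 2 by rewrite -(@pmulr_rgt0 _ M) ?MD; lra.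
by split=> //; apply: canRL (mulfK _) MD; rewrite gt_eqF.
Qed.

(** With a and b the two steps, the relation between M and z gives (M - 1) a
    = z - 1, which makes the multipliers solving the equations of the
    certificate simple multiples of (M - 1) (a (1 - b))^2. *)
Lemma hedged_error (R : realType) (M rho sigma z : R) (d : nat)
    (f : 'rV[R]_d -> R) (x0 xs : 'rV[R]_d) (I : finType)
    (g : 'rV[R]_d -> I -> 'rV[R]_d) :
  1 < M -> strongly_convex_smooth M f -> is_minimizer f xs ->
  enorm (x0 - xs) <= rho -> is_oracle sigma f g ->
  1 < z -> M * z ^+ 2 = (2 * M - 2) * z + M ->
  terminal_error g ((z + 1) / (M * z + 1)) ((z + 1) / (z + M)) x0 xs <=
  Tfun M z * rho ^+ 2 + Ufun M z * sigma ^+ 2.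
Proof.
move=> M1 fM xsmin x0rho gor z1 zM.
have Mz : M * z + 1 != 0 by rewrite gt_eqF //; nra.
have zM0 : z + M != 0 by rewrite gt_eqF //; lra.
have L0 : 0 < M - 1 by lra.
have La : (M - 1) * ((z + 1) / (M * z + 1)) = z - 1.
  by apply: (mulIf Mz); rewrite -!mulrA mulVf // mulr1; lra.
set a := (z + 1) / (M * z + 1) in La *; set b := (z + 1) / (z + M).
have b0 : 0 <= b by rewrite divr_ge0 //; lra.
have bM : 2 <= b * (M + 1).
  by rewrite /b mulrAC ler_pdivlMr; nra.
have k0 : 0 <= (M - 1) * (a * (1 - b)) ^+ 2 by rewrite mulr_ge0 ?sqr_ge0 // ltW.
have [D0 ME] := hedging_curvature M1 z1 zM.
have DM : 1 + 2 * z - z ^+ 2 != 0 by rewrite gt_eqF.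
have c1 : 2 * z * z + (1 + 2 * z - z ^+ 2) != 0 by rewrite gt_eqF //; nra.
have c2 : z * (1 + 2 * z - z ^+ 2) + 2 * z != 0 by rewrite gt_eqF //; nra.
have := @hedged_mean_error R M rho sigma d f x0 xs I g M1 fM xsmin x0rho gor a b
  ((z - 1) * ((M - 1) * (a * (1 - b)) ^+ 2))
  ((M - 1) * b ^+ 2 - z * ((M - 1) * (a * (1 - b)) ^+ 2))
  (z * ((M - 1) * (a * (1 - b)) ^+ 2)) ((M - 1) * (a * (1 - b)) ^+ 2).
have av : a * (1 - b) = b * (M - 1) / (M * z + 1).
  by rewrite /a /b; field; apply/andP.
have h1 : 0 <= (z - 1) * ((M - 1) * (a * (1 - b)) ^+ 2) by rewrite mulr_ge0 //; lra.
have h2 : 0 <= (M - 1) * b ^+ 2 - z * ((M - 1) * (a * (1 - b)) ^+ 2).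
  rewrite av.
  have -> : (M - 1) * b ^+ 2 - z * ((M - 1) * (b * (M - 1) / (M * z + 1)) ^+ 2) =
     (M - 1) * (b / (M * z + 1)) ^+ 2 * ((M * z + 1) ^+ 2 - z * (M - 1) ^+ 2).
    by field.
  apply: mulr_ge0; first by rewrite mulr_ge0 ?sqr_ge0 // ltW.
  have : 0 <= z * (z - 1) * M ^+ 2 by rewrite !mulr_ge0 ?sqr_ge0 //; lra.
  have : 0 <= z * M by apply: mulr_ge0; lra.
  nra.
have h3 : 0 <= z * ((M - 1) * (a * (1 - b)) ^+ 2) by rewrite mulr_ge0 //; lra.
move=> /(_ h1 h2 h3 k0).
have e1 : z * ((M - 1) * (a * (1 - b)) ^+ 2) =
   (z - 1) * ((M - 1) * (a * (1 - b)) ^+ 2) + (M - 1) * (a * (1 - b)) ^+ 2 by ring.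
have e2 : (M - 1) * b ^+ 2 - z * ((M - 1) * (a * (1 - b)) ^+ 2) +
    z * ((M - 1) * (a * (1 - b)) ^+ 2) = b ^+ 2 * (M - 1) by ring.
move=> /(_ e1 e2).
have e3 : (z - 1) * ((M - 1) * (a * (1 - b)) ^+ 2) +
   (M - 1) * (a * (1 - b)) ^+ 2 * a = 2 * (1 - a) * (1 - b) ^+ 2 * a.
  by rewrite /a /b ME; field; rewrite DM c1 c2.
have e4 : z * ((M - 1) * (a * (1 - b)) ^+ 2) =
    (M - 1) * ((M - 1) * (a * (1 - b)) ^+ 2 * a + (1 - b) ^+ 2 * a ^+ 2).
  transitivity ((M - 1) * ((M - 1) * a + 1) * (a * (1 - b)) ^+ 2); last by ring.
  by rewrite La; ring.
have e5 : z * ((M - 1) * (a * (1 - b)) ^+ 2) + (M - 1) * (a * (1 - b)) ^+ 2 =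
  (M - 1) * (a * (b ^+ 2 * (M - 1)) - 2 * (1 - b) * a * b).
  by rewrite /a /b ME; field; rewrite DM c1 c2.
have e6 : ((M - 1) * b ^+ 2 - z * ((M - 1) * (a * (1 - b)) ^+ 2)) * (1 - a) -
   z * ((M - 1) * (a * (1 - b)) ^+ 2) * a = 2 * (1 - a) * (1 - b) * b.
  by rewrite /a /b ME; field; rewrite DM c1 c2.
move=> /(_ e3 e4 e5 e6 bM b0) h.
apply: le_trans (terminal_error_le x0 xs gor a b) _.
apply: le_trans (lerD h (lexx _)) _.
le_by_eq.
rewrite /a /b /Tfun /Ufun; field; exact/andP.
Qed.

(** * Hard instances *)

Section HardInstance.
Context (R : realType).
Implicit Types (x y s t : R).

(** Its derivative is the minimum of x and t: quadratic on the left of t,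
    affine on the right. *)
Definition halfhuber t x : R := (x ^+ 2 - Num.max (x - t) 0 ^+ 2) / 2.

Lemma halfhuber_lower t x y :
  halfhuber t x + Num.min x t * (y - x) <= halfhuber t y.
Proof.
rewrite /halfhuber; case: (leP x t) => xt; case: (leP y t) => yt.
- rewrite !max_r ?subr_le0 //; have := sqr_ge0 (x - y); nra.
- rewrite [Num.max (x - t) 0]max_r ?subr_le0 // [Num.max (y - t) 0]max_l ?subr_ge0 ?(ltW yt) //.
  have : 0 <= (t - x) * (y - t) by rewrite mulr_ge0 ?subr_ge0 // ltW.
  have := sqr_ge0 (y - t); have := sqr_ge0 (t - x); nra.
- rewrite [Num.max (x - t) 0]max_l ?subr_ge0 ?(ltW xt) // [Num.max (y - t) 0]max_r ?subr_le0 //.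
  have : 0 <= (x - t) * (t - y) by rewrite mulr_ge0 ?subr_ge0 // ltW.
  have := sqr_ge0 (y - t); have := sqr_ge0 (x - t); nra.
- rewrite !max_l ?subr_ge0 ?(ltW xt) ?(ltW yt) //; have := sqr_ge0 (x - y); nra.
Qed.

Lemma halfhuber_upper t x y :
  halfhuber t y <= halfhuber t x + Num.min x t * (y - x) + (y - x) ^+ 2 / 2.
Proof.
rewrite /halfhuber; case: (leP x t) => xt; case: (leP y t) => yt.
- rewrite !max_r ?subr_le0 //; have := sqr_ge0 (x - y); nra.
- rewrite [Num.max (x - t) 0]max_r ?subr_le0 // [Num.max (y - t) 0]max_l ?subr_ge0 ?(ltW yt) //.
  have : 0 <= (t - x) * (y - t) by rewrite mulr_ge0 ?subr_ge0 // ltW.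
  have := sqr_ge0 (y - t); have := sqr_ge0 (t - x); nra.
- rewrite [Num.max (x - t) 0]max_l ?subr_ge0 ?(ltW xt) // [Num.max (y - t) 0]max_r ?subr_le0 //.
  have : 0 <= (x - t) * (t - y) by rewrite mulr_ge0 ?subr_ge0 // ltW.
  have := sqr_ge0 (y - t); have := sqr_ge0 (x - t); nra.
- rewrite !max_l ?subr_ge0 ?(ltW xt) ?(ltW yt) //; have := sqr_ge0 (x - y); nra.
Qed.

Lemma min_slope t x y : exists k,
  [/\ 0 <= k, k <= 1 & Num.min x t - Num.min y t = k * (x - y)].
Proof.
have [->|xy] := eqVneq x y; first by exists 0; split; rewrite ?subrr ?mulr0.
exists ((Num.min x t - Num.min y t) / (x - y)).
have xy0 : x - y != 0 by rewrite subr_eq0.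
rewrite mulfVK //; split=> //.
  case: (ltgtP x y) xy => // xy _.
    rewrite ler_ndivlMr ?subr_lt0 // mul0r subr_le0.
    by case: (leP x t); case: (leP y t); lra.
  rewrite ler_pdivlMr ?subr_gt0 // mul0r subr_ge0.
  by case: (leP x t); case: (leP y t); lra.
case: (ltgtP x y) xy => // xy _.
  rewrite ler_ndivrMr ?subr_lt0 // mul1r.
  by case: (leP x t); case: (leP y t); lra.
rewrite ler_pdivrMr ?subr_gt0 // mul1r.
by case: (leP x t); case: (leP y t); lra.
Qed.

Definition vec2 x y : 'rV[R]_2 := \row_j (if j == 0 then x else y).

Lemma vec20 x y : vec2 x y 0 0 = x. Proof. by rewrite mxE. Qed.
Lemma vec21 x y : vec2 x y 0 1 = y. Proof. by rewrite mxE. Qed.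

Lemma vec2P (u v : 'rV[R]_2) : u 0 0 = v 0 0 -> u 0 1 = v 0 1 -> u = v.
Proof.
move=> e0 e1; apply/rowP => j; case: (unliftP 0 j) => [k ->|-> //].
by rewrite ord1 (_ : lift 0 0 = 1) //; apply/val_inj.
Qed.

Lemma dotv2 (u v : 'rV[R]_2) : dotv u v = u 0 0 * v 0 0 + u 0 1 * v 0 1.
Proof.
rewrite /dotv big_ord_recl big_ord1; congr (_ + _).
by rewrite (_ : lift 0 0 = 1) //; apply/val_inj.
Qed.

Context (M rho sigma p r q t s : R).
Hypotheses (t0 : 0 <= t) (p1 : 1 <= p) (r0 : 0 <= r) (prM : p + r <= M).
Hypotheses (q1 : 1 <= q) (qM : q <= M) (srho : `|s| <= rho).

(** The starting point lies on the first axis, where the slope is p x + r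
    min(x, t); the noise acts along the second axis, of constant curvature q.
    The two contributions to the error then add up. *)
Definition hard (v : 'rV[R]_2) : R :=
  p / 2 * v 0 0 ^+ 2 + r * halfhuber t (v 0 0) + q / 2 * v 0 1 ^+ 2.

Definition hard_grad (v : 'rV[R]_2) : 'rV[R]_2 :=
  vec2 (p * v 0 0 + r * Num.min (v 0 0) t) (q * v 0 1).

Definition hard_oracle (v : 'rV[R]_2) (i : bool) : 'rV[R]_2 :=
  hard_grad v + (if i then sigma else - sigma) *: vec2 0 1.

Definition hard_step (k x : R) : R := x - k * (p * x + r * Num.min x t).

Lemma hard_lower u v :
  hard u + dotv (hard_grad u) (v - u) + 2^-1 * dotv (v - u) (v - u) <= hard v.
Proof.
rewrite /hard /hard_grad !dotv2 vec20 vec21 !mxE.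
have := ler_wpM2l r0 (halfhuber_lower t (u 0 0) (v 0 0)).
move: (u 0 0) (v 0 0) (u 0 1) (v 0 1) (halfhuber _ _) (halfhuber _ _) (Num.min _ _).
move=> x y x' y' h h' m H.
have p1' := p1; have q1' := q1.
have : 0 <= (p - 1) * (y - x) ^+ 2 by rewrite mulr_ge0 ?sqr_ge0 //; lra.
have : 0 <= (q - 1) * (y' - x') ^+ 2 by rewrite mulr_ge0 ?sqr_ge0 //; lra.
nra.
Qed.

Lemma hard_upper u v :
  hard v <= hard u + dotv (hard_grad u) (v - u) + M / 2 * dotv (v - u) (v - u).
Proof.
rewrite /hard /hard_grad !dotv2 vec20 vec21 !mxE.
have := ler_wpM2l r0 (halfhuber_upper t (u 0 0) (v 0 0)).
move: (u 0 0) (v 0 0) (u 0 1) (v 0 1) (halfhuber _ _) (halfhuber _ _) (Num.min _ _).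
move=> x y x' y' h h' m H.
have prM' := prM; have qM' := qM.
have : 0 <= (M - p - r) * (y - x) ^+ 2 by rewrite mulr_ge0 ?sqr_ge0 //; lra.
have : 0 <= (M - q) * (y' - x') ^+ 2 by rewrite mulr_ge0 ?sqr_ge0 //; lra.
nra.
Qed.

Lemma hard_diff v : differentiable hard v /\ grad hard v = hard_grad v.
Proof.
have M0 : 0 <= M / 2 by have := p1; have := prM; have := r0; lra.
apply: (@grad_of_quadratic_bound _ _ _ _ _ (M / 2)) => y.
have := hard_upper v y; have := hard_lower v y; have := dotv_ge0 (y - v).
by rewrite ler_norml => *; apply/andP; split; nra.
Qed.

Lemma hard_class : strongly_convex_smooth M hard.
Proof.
split=> [x|x y|x y]; first by have [] := hard_diff x.
  by have [_ ->] := hard_diff x; rewrite enorm_sqr; exact: hard_lower.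
have [[_ ->] [_ ->]] := (hard_diff x, hard_diff y).
have M0 : 0 <= M by have := p1; have := prM; have := r0; lra.
rewrite -(@ler_pXn2r _ 2) ?nnegrE ?mulr_ge0 ?enorm_ge0 // exprMn !enorm_sqr.
rewrite !dotv2 /hard_grad !mxE /=.
have [k [k0 k1 mk]] := min_slope t (x 0 0) (y 0 0).
have -> : p * x 0 0 + r * Num.min (x 0 0) t - (p * y 0 0 + r * Num.min (y 0 0) t) =
    (p + r * k) * (x 0 0 - y 0 0).
  by rewrite mulrDl -mulrA -mk; ring.
rewrite -!expr2 -[q * _ - _]mulrBr !exprMn mulrDr.
have p1' := p1; have prM' := prM; have r0' := r0; have qM' := qM; have q1' := q1.
apply: lerD; apply: ler_wpM2r; rewrite ?sqr_ge0 // lerXn2r ?nnegrE //; nra.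
Qed.

Lemma hard_minimizer : is_minimizer hard 0.
Proof.
move=> y; have := hard_lower 0 y; rewrite subr0.
have -> : hard_grad 0 = 0.
  by apply: vec2P; rewrite !mxE /= ?(min_l t0) !mulr0 ?addr0.
rewrite dotv0l addr0; apply: le_trans.
by rewrite lerDl mulr_ge0 ?dotv_ge0.
Qed.

Lemma hard_is_oracle : is_oracle sigma hard hard_oracle.
Proof.
split=> [|x|x]; first by rewrite card_bool.
  have [_ ->] := hard_diff x; rewrite card_bool big_bool /hard_oracle /=.
  by apply: vec2P; rewrite !mxE /=; field.
have [_ ->] := hard_diff x; rewrite card_bool big_bool /hard_oracle /=.
rewrite !(addrC (hard_grad x)) !addrK !enorm_sqr !dotv2 !mxE /=.
by le_by_eq; field.
Qed.

Lemma hard_error a b :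
  terminal_error hard_oracle a b (vec2 s 0) 0 =
  hard_step b (hard_step a s) ^+ 2 +
  (a ^+ 2 * (1 - b * q) ^+ 2 + b ^+ 2) * sigma ^+ 2.
Proof.
rewrite terminal_error_avg /avg !big_bool !dotv2 /hard_step card_bool.
rewrite /sg_step /hard_oracle /hard_grad !mxE /=.
rewrite !mulr0 !addr0 !oppr0 ?addr0.
by field.
Qed.

Lemma worst_case_error_hard a b :
  ((hard_step b (hard_step a s) ^+ 2 +
    (a ^+ 2 * (1 - b * q) ^+ 2 + b ^+ 2) * sigma ^+ 2)%:E
   <= worst_case_error M rho sigma (a, b))%E.
Proof.
apply: ereal_sup_ubound; exists 2%N, hard, (vec2 s 0), 0, bool, hard_oracle; split.
- by split=> //; exact: hard_class.
- exact: hard_minimizer.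
- rewrite subr0; apply: le_trans srho.
  by rewrite /enorm dotv2 !mxE /= mulr0 addr0 -expr2 sqrtr_sqr.
- exact: hard_is_oracle.
- by rewrite hard_error.
Qed.

End HardInstance.

Section LowerBounds.
Context (R : realType) (M rho sigma a b : R).
Hypotheses (M1 : 1 < M) (rho0 : 0 <= rho).
Implicit Types p q c : R.

Definition noise_term q : R := a ^+ 2 * (1 - b * q) ^+ 2 + b ^+ 2.

Let bounded_by c q :=
  ((c ^+ 2 * rho ^+ 2 + noise_term q * sigma ^+ 2)%:E
    <= worst_case_error M rho sigma (a, b))%E.

Lemma quadratic_lower_bound p q : 1 <= p -> p <= M -> 1 <= q -> q <= M ->
  bounded_by ((1 - a * p) * (1 - b * p)) q.
Proof.
move=> p1 pM q1 qM.
have := @worst_case_error_hard R M rho sigma p 0 q 0 rho (lexx 0) p1 (lexx 0) _ q1 qM _ a b.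
rewrite addr0 ger0_norm // => /(_ pM (lexx _)); rewrite /bounded_by /noise_term /hard_step.
set u := (X in (X ^+ 2)).
have -> : u = (1 - a * p) * (1 - b * p) * rho by rewrite /u; ring.
by rewrite exprMn.
Qed.

(** The first step starts on the side of curvature M and jumps over the
    minimizer to the side of curvature 1. *)
Lemma overshoot_lower_bound q : 1 <= M * a -> 1 <= q -> q <= M ->
  bounded_by ((1 - a * M) * (1 - b)) q.
Proof.
move=> aM q1 qM; have L0 : 0 <= M - 1 by rewrite subr_ge0 ltW.
have := @worst_case_error_hard R M rho sigma 1 (M - 1) q 0 (- rho)
  (lexx 0) (lexx 1) L0 _ q1 qM _ a b.
rewrite normrN ger0_norm // addrC subrK => /(_ (lexx _) (lexx _)).
rewrite /bounded_by /noise_term /hard_step min_l ?oppr_le0 //.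
rewrite [Num.min _ 0]min_r; last first.
  have : 0 <= rho * (M * a - 1) by rewrite mulr_ge0 // subr_ge0.
  lra.
set u := (X in (X ^+ 2)).
have -> : u = - ((1 - a * M) * (1 - b) * rho) by rewrite /u; ring.
by rewrite sqrrN exprMn.
Qed.

(** The kink t is placed at the first iterate: the first step is short
    because the added slope is constant beyond the kink, and the second one
    overshoots because it is taken where the curvature is M. *)
Lemma huber_lower_bound q : 0 <= a -> a <= 1 -> 1 <= q -> q <= M ->
  bounded_by ((1 - a) * (1 - b * M) / (1 + a * (M - 1))) q.
Proof.
move=> a0 a1 q1 qM; have L0 : 0 <= M - 1 by rewrite subr_ge0 ltW.
have D0 : 0 < 1 + a * (M - 1) by rewrite ltr_wpDr // mulr_ge0.
set t := (1 - a) * rho / (1 + a * (M - 1)).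
have t0 : 0 <= t by rewrite divr_ge0 ?(ltW D0) // mulr_ge0 // subr_ge0.
have trho : t <= rho.
  by rewrite ler_pdivrMr //; have := mulr_ge0 rho0 (mulr_ge0 a0 L0); have := mulr_ge0 rho0 a0; nra.
have := @worst_case_error_hard R M rho sigma 1 (M - 1) q t rho t0 (lexx 1) L0 _ q1 qM _ a b.
rewrite ger0_norm // addrC subrK => /(_ (lexx _) (lexx _)).
rewrite /bounded_by /noise_term /hard_step [Num.min rho t]min_r //.
have -> : rho - a * (1 * rho + (M - 1) * t) = t by rewrite /t; field; rewrite gt_eqF.
rewrite minxx; set u := (X in (X ^+ 2)).
have -> : u = (1 - a) * (1 - b * M) / (1 + a * (M - 1)) * rho.
  by rewrite /u /t; field; rewrite gt_eqF.
by rewrite exprMn.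
Qed.

End LowerBounds.

(** * Optimization over the steps *)

Section Dominated.
Context (R : realType).
Implicit Types (M g a b k W : R).

(** What the hard instances give on W sigma^2, when W sigma^2 bounds the
    error of the steps (a, b) and g = rho^2 / sigma^2. *)
Definition dominates M g a b W : Prop :=
  [/\ forall p q, 1 <= p -> p <= M -> 1 <= q -> q <= M ->
        ((1 - a * p) * (1 - b * p)) ^+ 2 * g + noise_term a b q <= W,
      forall q, 1 <= M * a -> 1 <= q -> q <= M ->
        ((1 - a * M) * (1 - b)) ^+ 2 * g + noise_term a b q <= W
    & forall q, 0 <= a -> a <= 1 -> 1 <= q -> q <= M ->
        ((1 - a) * (1 - b * M) / (1 + a * (M - 1))) ^+ 2 * g + noise_term a b q <= W].

Lemma complete_square k b : 0 <= k ->
  (1 - b) ^+ 2 * k + b ^+ 2 = k / (1 + k) + (1 + k) * (b - k / (1 + k)) ^+ 2.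
Proof. by move=> k0; field; rewrite gt_eqF //; lra. Qed.

(** Completing squares for the quadratic instance of curvature 1, first in a
    and then in b. *)
Lemma V1_le M g a b W : 1 < M -> 0 <= g -> dominates M g a b W ->
  V1 g <= W /\ (W = V1 g -> (a, b) = (g / (1 + g), g / (1 + 2 * g))).
Proof.
move=> M1 g0 [quad _ _]; have := quad 1 1 (lexx _) (ltW M1) (lexx _) (ltW M1).
rewrite /noise_term !mulr1 /V1 => h.
have g1 : 0 < 1 + g by lra. have g2 : 0 < 1 + 2 * g by lra.
have g1' : 1 + g != 0 by rewrite gt_eqF. have g2' : 1 + 2 * g != 0 by rewrite gt_eqF.
set b0 := g / (1 + 2 * g).
have E : ((1 - a) * (1 - b)) ^+ 2 * g + (a ^+ 2 * (1 - b) ^+ 2 + b ^+ 2) =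
    b0 + (1 + 2 * g) / (1 + g) * (b - b0) ^+ 2
       + (1 + g) * ((1 - b) * (a - g / (1 + g))) ^+ 2.
  by rewrite /b0; field; rewrite g1' g2'.
have s1 : 0 <= (1 + 2 * g) / (1 + g) * (b - b0) ^+ 2.
  by rewrite mulr_ge0 ?sqr_ge0 // divr_ge0 // ltW.
have s2 : 0 <= (1 + g) * ((1 - b) * (a - g / (1 + g))) ^+ 2.
  by rewrite mulr_ge0 ?sqr_ge0 // ltW.
rewrite {}E in h; split; first lra.
move=> We; have /eqP : (1 + 2 * g) / (1 + g) * (b - b0) ^+ 2 = 0 by lra.
rewrite mulf_eq0 sqrf_eq0 subr_eq0 gt_eqF ?divr_gt0 //= => /eqP bE.
have /eqP : (1 + g) * ((1 - b) * (a - g / (1 + g))) ^+ 2 = 0 by lra.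
rewrite mulf_eq0 sqrf_eq0 mulf_eq0 subr_eq0 gt_eqF //= bE subr_eq0.
have -> : (1 == b0) = false.
  by rewrite /b0 eq_sym -(inj_eq (mulIf g2')) mulfVK // mul1r lt_eqF //; lra.
by move=> /eqP ->.
Qed.

(** The error, in units of sigma^2, after a first step alphabar. *)
Definition K2 M g := (g * (M - 1) ^+ 2 + 4) / (M + 1) ^+ 2.

Lemma V2E M g : 0 < M -> 0 <= g -> V2 M g = K2 M g / (1 + K2 M g).
Proof.
move=> M0 g0; rewrite /V2 /K2; have := mulr_ge0 g0 (sqr_ge0 (M - 1)) => h.
have k : 0 < (M + 1) ^+ 2 by rewrite exprn_gt0 //; lra.
have k' : 0 < g * (M - 1) ^+ 2 + 4 + (M + 1) ^+ 2 by lra.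
field; rewrite !gt_eqF //; lra.
Qed.

Lemma K2_ge0 M g : 0 <= g -> 0 <= K2 M g.
Proof.
by move=> g0; rewrite /K2 divr_ge0 ?sqr_ge0 // addr_ge0 // mulr_ge0 // sqr_ge0.
Qed.

Lemma alphabarE M : 0 < M -> alphabar M * (M + 1) = 2.
Proof. by move=> M0; rewrite /alphabar mulfVK // gt_eqF //; lra. Qed.

Lemma short_first_step M g a : 1 < M -> 2 <= g * (M - 1) -> a <= alphabar M ->
  K2 M g <= (1 - a) ^+ 2 * g + a ^+ 2 /\
  ((1 - a) ^+ 2 * g + a ^+ 2 = K2 M g -> a = alphabar M).
Proof.
move=> M1 gM aa; have Mp : 0 < M + 1 by lra.
have g0 : 0 < g by rewrite -(@pmulr_lgt0 _ (M - 1)); lra.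
have Mp' : M + 1 != 0 by rewrite gt_eqF.
have aE := alphabarE (lt_trans ltr01 M1).
have E : (1 - a) ^+ 2 * g + a ^+ 2 - K2 M g =
   (alphabar M - a) ^+ 2 +
   (alphabar M - a) * ((2 * g - 2 * (1 + g) * alphabar M) + g * (alphabar M - a)).
  by rewrite /K2 /alphabar; field.
have s : 0 <= 2 * g - 2 * (1 + g) * alphabar M.
  rewrite -(pmulr_lge0 _ Mp).
  have -> : (2 * g - 2 * (1 + g) * alphabar M) * (M + 1) = 2 * (g * (M - 1) - 2).
    transitivity (2 * g * (M + 1) - 2 * (1 + g) * (alphabar M * (M + 1))); first by ring.
    by rewrite aE; ring.
  lra.
have d0 : 0 <= alphabar M - a by rewrite subr_ge0.
have d1 : 0 <= (alphabar M - a) *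
    ((2 * g - 2 * (1 + g) * alphabar M) + g * (alphabar M - a)).
  by apply: mulr_ge0 => //; apply: addr_ge0 => //; apply: mulr_ge0 => //; exact: ltW.
have d2 := sqr_ge0 (alphabar M - a).
split; first by rewrite -subr_ge0 E addr_ge0.
move=> k; apply/eqP; rewrite eq_sym -subr_eq0 -sqrf_eq0 eq_le d2 andbT.
by move: E; rewrite k subrr; lra.
Qed.

(** The instance of curvature 1 handles the first steps below alphabar, and
    the overshooting one those above; both leave a second step that contracts
    by 1 - b. *)
Lemma first_step_le M g a b W : 1 < M -> 2 <= g * (M - 1) -> 0 <= a ->
  dominates M g a b W -> exists k,
  [/\ (1 - b) ^+ 2 * k + b ^+ 2 <= W, K2 M g <= k & (k = K2 M g -> a = alphabar M)].
Proof.
move=> M1 gM a0 [quad over _]; have Mp : 0 < M + 1 by lra.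
have g0 : 0 < g by rewrite -(@pmulr_lgt0 _ (M - 1)); lra.
have Mp' : M + 1 != 0 by rewrite gt_eqF.
have aE := alphabarE (lt_trans ltr01 M1).
case: (leP a (alphabar M)) => [aa|aa].
  have [kK kE] := short_first_step M1 gM aa.
  exists ((1 - a) ^+ 2 * g + a ^+ 2); split=> //.
  have := quad 1 1 (lexx _) (ltW M1) (lexx _) (ltW M1).
  rewrite /noise_term !mulr1 => h.
  by apply: le_trans h; le_by_eq; ring.
exists ((1 - a * M) ^+ 2 * g + a ^+ 2).
have Ma : 1 <= M * a.
  have : 0 <= (a - alphabar M) * (M + 1).
    by apply: mulr_ge0; [rewrite subr_ge0|]; exact: ltW.
  by rewrite mulrBl aE; nra.
have := over 1 Ma (lexx _) (ltW M1); rewrite /noise_term mulr1 => h.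
have E : (1 - a * M) ^+ 2 * g + a ^+ 2 - K2 M g =
   (a - alphabar M) * (g * M * (M * a - 1 + (M * alphabar M - 1)) + (a + alphabar M)).
  by rewrite /K2 /alphabar; field.
have Ka : 0 <= M * alphabar M - 1.
  rewrite -(pmulr_lge0 _ Mp) mulrBl -mulrA aE; lra.
have ap : 0 < alphabar M by rewrite divr_gt0.
have P : 0 < (1 - a * M) ^+ 2 * g + a ^+ 2 - K2 M g.
  rewrite E mulr_gt0 ?subr_gt0 // ltr_wpDl //; last lra.
  by rewrite !mulr_ge0 ?(ltW g0) //; lra.
split; first by apply: le_trans h; le_by_eq; ring.
  by rewrite -subr_ge0 ltW.
by move=> k; move: P; rewrite k subrr ltxx.
Qed.

Lemma V2_le_second_step M g b k : 1 < M -> 0 <= g -> K2 M g <= k ->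
  V2 M g <= (1 - b) ^+ 2 * k + b ^+ 2 /\
  ((1 - b) ^+ 2 * k + b ^+ 2 = V2 M g -> b = V2 M g /\ k = K2 M g).
Proof.
move=> M1 g0; have M0 : 0 < M by lra.
rewrite V2E //; have := K2_ge0 M g0; move: (K2 M g) => K K0 kK.
have h : 0 <= (1 - b) ^+ 2 * (k - K) by rewrite mulr_ge0 ?sqr_ge0 // subr_ge0.
have h' : 0 <= (1 + K) * (b - K / (1 + K)) ^+ 2 by rewrite mulr_ge0 ?sqr_ge0 //; lra.
have E := complete_square b K0.
split; first by lra.
move=> We; have /eqP : (1 + K) * (b - K / (1 + K)) ^+ 2 = 0 by lra.
have K1 : 1 + K != 0 by rewrite gt_eqF //; lra.
rewrite mulf_eq0 (negbTE K1) sqrf_eq0 subr_eq0 /= => /eqP bE.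
have /eqP : (1 - b) ^+ 2 * (k - K) = 0 by lra.
rewrite mulf_eq0 sqrf_eq0 !subr_eq0 => /orP[|/eqP -> //].
by rewrite bE eq_sym -(inj_eq (mulIf K1)) mulfVK // mul1r lt_eqF //; lra.
Qed.

Lemma V2_le M g a b W : 1 < M -> 2 <= g * (M - 1) -> 0 <= a -> dominates M g a b W ->
  V2 M g <= W /\ (W = V2 M g -> (a, b) = (alphabar M, V2 M g)).
Proof.
move=> M1 gM a0 dom.
have g0 : 0 <= g by rewrite ltW // -(@pmulr_lgt0 _ (M - 1)); lra.
have [k [kW kK kE]] := first_step_le M1 gM a0 dom.
have [h1 h2] := V2_le_second_step b M1 g0 kK.
split=> [|We]; first exact: le_trans kW.
have [|bE /kE ->] := h2; last by rewrite bE.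
by apply/eqP; rewrite eq_le h1 andbT -We.
Qed.

Lemma V3E M g : 0 < M ->
  V3 M g = (1 - alphabar M) ^+ 2 * K2 M g + alphabar M ^+ 2.
Proof.
move=> M0; rewrite /V3 /Tfun /Ufun /K2 /alphabar; field.
by rewrite !gt_eqF //; lra.
Qed.

(** Beyond gamma2 the unconstrained optimal second step exceeds alphabar, so
    that the bound decreases in b up to alphabar. *)
Lemma V3_le_short M g a b W : 1 < M -> 2 * (M ^+ 2 + 3) <= g * (M - 1) ^+ 3 ->
  2 <= g * (M - 1) -> 0 <= a -> b <= alphabar M -> dominates M g a b W ->
  V3 M g <= W /\ (W = V3 M g -> (a, b) = (alphabar M, alphabar M)).
Proof.
move=> M1 g2 gM a0 bb dom; have M0 : 0 < M by lra.
have g0 : 0 <= g by rewrite ltW // -(@pmulr_lgt0 _ (M - 1)); lra.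
have [k [kW kK kE]] := first_step_le M1 gM a0 dom.
have K0 := K2_ge0 M g0.
have Kb : 0 <= K2 M g * (1 - alphabar M) - alphabar M.
  have -> : K2 M g * (1 - alphabar M) - alphabar M =
     (g * (M - 1) ^+ 3 - 2 * (M ^+ 2 + 3)) / (M + 1) ^+ 3.
    by rewrite /K2 /alphabar; field; rewrite gt_eqF //; lra.
  by rewrite divr_ge0 ?exprn_ge0 ?subr_ge0 //; lra.
have ab1 : alphabar M < 1 by rewrite /alphabar ltr_pdivrMr; lra.
rewrite V3E //; move: (K2 M g) K0 kK kE Kb => K K0 kK kE Kb.
have h : 0 <= (1 - b) ^+ 2 * (k - K) by rewrite mulr_ge0 ?sqr_ge0 // subr_ge0.
have h' : 0 <= (alphabar M - b) * (2 * (K * (1 - alphabar M) - alphabar M)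
   + K * (alphabar M - b)).
  have d0 : 0 <= alphabar M - b by rewrite subr_ge0.
  by apply: mulr_ge0 => //; apply: addr_ge0; apply: mulr_ge0.
have h2 := sqr_ge0 (alphabar M - b).
have E : (1 - b) ^+ 2 * k + b ^+ 2 - ((1 - alphabar M) ^+ 2 * K + alphabar M ^+ 2) =
  (1 - b) ^+ 2 * (k - K) + (alphabar M - b) * (2 * (K * (1 - alphabar M) - alphabar M)
   + K * (alphabar M - b)) + (alphabar M - b) ^+ 2 by ring.
split; first lra.
move=> We; have /eqP : (alphabar M - b) ^+ 2 = 0 by lra.
rewrite sqrf_eq0 subr_eq0 => /eqP bE.
have /eqP : (1 - b) ^+ 2 * (k - K) = 0 by lra.
rewrite mulf_eq0 sqrf_eq0 !subr_eq0 -bE => /orP[|/eqP /kE -> //].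
by rewrite gt_eqF.
Qed.

(** The quadratic of curvature M gets worse when either step grows. *)
Lemma V3_le_long M g a b W : 1 < M -> 0 <= g -> alphabar M <= a -> alphabar M <= b ->
  dominates M g a b W ->
  V3 M g <= W /\ (W = V3 M g -> (a, b) = (alphabar M, alphabar M)).
Proof.
move=> M1 g0 aa bb [quad _ _]; have M0 : 0 < M by lra.
have := quad M M (ltW M1) (lexx _) (ltW M1) (lexx _); rewrite /noise_term => h.
have Mp : 0 < M + 1 by lra.
have Ka : 0 < M * alphabar M - 1.
  rewrite -(pmulr_lgt0 _ Mp) mulrBl -mulrA /alphabar mulfVK ?gt_eqF //; lra.
have ap : 0 < alphabar M by rewrite divr_gt0.
have -> : V3 M g = (M * alphabar M - 1) ^+ 2 * ((M * alphabar M - 1) ^+ 2 * g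
    + alphabar M ^+ 2) + alphabar M ^+ 2.
  by rewrite V3E // /K2 /alphabar; field; rewrite gt_eqF.
have {}h : (M * b - 1) ^+ 2 * ((M * a - 1) ^+ 2 * g + a ^+ 2) + b ^+ 2 <= W.
  by apply: le_trans h; le_by_eq; ring.
have sq (x y : R) : 0 <= x -> x <= y -> x ^+ 2 <= y ^+ 2.
  by move=> x0 xy; rewrite lerXn2r ?nnegrE //; exact: le_trans xy.
have h1 : (M * alphabar M - 1) ^+ 2 <= (M * a - 1) ^+ 2.
  by apply: sq; [exact: ltW | rewrite lerB // ler_wpM2l // ltW].
have h2 : (M * alphabar M - 1) ^+ 2 <= (M * b - 1) ^+ 2.
  by apply: sq; [exact: ltW | rewrite lerB // ler_wpM2l // ltW].
have h3 : (M * alphabar M - 1) ^+ 2 * g <= (M * a - 1) ^+ 2 * g by rewrite ler_wpM2r.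
have h4 : 0 <= a ^+ 2 - alphabar M ^+ 2 by rewrite subr_ge0 sq // ltW.
have h5 : 0 <= b ^+ 2 - alphabar M ^+ 2 by rewrite subr_ge0 sq // ltW.
have c0 : 0 < (M * alphabar M - 1) ^+ 2 by rewrite exprn_gt0.
have g1 : 0 <= (M * a - 1) ^+ 2 * g by rewrite mulr_ge0 ?sqr_ge0.
have h6 : (M * alphabar M - 1) ^+ 2 * ((M * a - 1) ^+ 2 * g + a ^+ 2) <=
    (M * b - 1) ^+ 2 * ((M * a - 1) ^+ 2 * g + a ^+ 2).
  by rewrite ler_wpM2r // addr_ge0 ?sqr_ge0.
have h7 := mulr_ge0 (ltW c0) h4.
have h8 : 0 <= (M * alphabar M - 1) ^+ 2 * ((M * a - 1) ^+ 2 * g - (M * alphabar M - 1) ^+ 2 * g).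
  by rewrite mulr_ge0 ?subr_ge0 // ltW.
have E : forall x, alphabar M <= x -> x ^+ 2 - alphabar M ^+ 2 = 0 -> x = alphabar M.
  move=> x xa; rewrite subr_sqr => /eqP; rewrite mulf_eq0 subr_eq0 => /orP[/eqP //|].
  by rewrite gt_eqF //; lra.
split; first by lra.
move=> We.
have hb : b ^+ 2 - alphabar M ^+ 2 = 0 by lra.
have /eqP : (M * alphabar M - 1) ^+ 2 * (a ^+ 2 - alphabar M ^+ 2) = 0 by lra.
rewrite mulf_eq0 (gt_eqF c0) /= => /eqP ha.
by rewrite (E b bb hb) (E a aa ha).
Qed.

End Dominated.

(** * Errors along the curve *)

Section Chord.
Context (R : realType).
Implicit Types (M L x y t z : R).

(** With x = t - 1 and L = M - 1, chord_num and chord_den are what remains of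
    the gaps of U and of T between the points 1 and t of the curve, after
    removing their zeros at t = 1 and their positive factors; see Ufun_gap
    and Tfun_gap. *)
Definition chord_num L x : R :=
  8 * L * (1 + L) * (2 + L) ^+ 4
  + 2 * L * (2 + L) ^+ 2 * (24 + 56 * L + 38 * L ^+ 2 + 9 * L ^+ 3) * x
  + 2 * L * (2 + L) ^+ 2 * (12 + 32 * L + 23 * L ^+ 2 + 6 * L ^+ 3) * x ^+ 2
  + L * (16 + 64 * L + 88 * L ^+ 2 + 57 * L ^+ 3 + 18 * L ^+ 4 + 2 * L ^+ 5) * x ^+ 3.

Definition chord_den L x : R := 2 * (2 + L) ^+ 2 * (1 + x) + (1 + L) * x ^+ 2.

Definition curve_den M t : R := (M * t + 1) * (t + M).

Lemma Tfun_gap M t : 0 < M -> 0 < t ->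
  Tfun M 1 - Tfun M t = (M - 1) ^+ 4 * M * (t - 1) ^+ 2 * chord_den (M - 1) (t - 1)
     / ((M + 1) ^+ 4 * curve_den M t ^+ 2).
Proof.
move=> M0 t0; have := mulr_gt0 M0 t0 => Mt.
rewrite /Tfun /chord_den /curve_den; field.
by rewrite !gt_eqF //; lra.
Qed.

Lemma Ufun_gap M t : 0 < M -> 0 < t ->
  Ufun M t - Ufun M 1 = (t - 1) * chord_num (M - 1) (t - 1)
     / ((M + 1) ^+ 4 * curve_den M t ^+ 2).
Proof.
move=> M0 t0; have := mulr_gt0 M0 t0 => Mt.
rewrite /Ufun /chord_num /curve_den; field.
by rewrite !gt_eqF //; lra.
Qed.

(** The ratio of the gap of U to the gap of T, up to a constant, decreases
    along the curve. The cross product factors by y - x, and its cofactor is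
    positive since x y <= 2. *)
Lemma chord_ratio_decreasing L x y : 0 < L -> 0 < x -> x < y -> y ^+ 2 <= 2 ->
  chord_num L y * (x * chord_den L x) < chord_num L x * (y * chord_den L y).
Proof.
move=> L0 x0 xy y2; rewrite /chord_num /chord_den.
set p0 := 8 * L * _ * _; set p1 := 2 * L * _ * _; set p2 := 2 * L * _ * _.
set p3 := L * _; set q0 := 2 * _; set q2 := 1 + L.
have y0 : 0 < y by lra.
have q0_gt0 : 0 < q0 by rewrite mulr_gt0 // exprn_gt0 //; lra.
have q2_gt0 : 0 < q2 by rewrite /q2; lra.
have Lk k : 0 <= L ^+ k by rewrite exprn_ge0 // ltW.
have p03 : 0 <= p0 - 2 * p3.
  have -> : p0 - 2 * p3 = 96 * L + 256 * L ^+ 2 + 272 * L ^+ 3 + 142 * L ^+ 4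
     + 36 * L ^+ 5 + 4 * L ^+ 6 by rewrite /p0 /p3; ring.
  nonneg.
have p123 : 0 <= p1 - p2 - 2 * p3.
  have -> : p1 - p2 - 2 * p3 = 64 * L + 160 * L ^+ 2 + 160 * L ^+ 3 + 78 * L ^+ 4
     + 18 * L ^+ 5 + 2 * L ^+ 6 by rewrite /p1 /p2 /p3; ring.
  nonneg.
have p0_gt0 : 0 < p0 by rewrite /p0 !mulr_gt0 ?exprn_gt0 //; lra.
have p2_ge0 : 0 <= p2 by rewrite /p2; nonneg.
have p3_ge0 : 0 <= p3 by rewrite /p3; nonneg.
clearbody p0 p1 p2 p3 q0 q2.
have s0 : 0 <= x * y by rewrite mulr_ge0 // ltW.
have s2 : x * y <= 2 by apply: le_trans y2; rewrite expr2 ler_wpM2r // ltW.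
have xy0 : 0 <= x + y by lra.
rewrite -subr_gt0.
have -> : (p0 + p1 * x + p2 * x ^+ 2 + p3 * x ^+ 3) * (y * (q0 * (1 + y) + q2 * y ^+ 2)) -
  (p0 + p1 * y + p2 * y ^+ 2 + p3 * y ^+ 3) * (x * (q0 * (1 + x) + q2 * x ^+ 2)) =
  (y - x) * (p0 * q0 + (x + y) * q0 * (p0 - 2 * p3 + p3 * (2 - x * y))
    + x * y * q0 * (p1 - p2 - 2 * p3 + p3 * (2 - x * y))
    + p0 * q2 * (x ^+ 2 + x * y + y ^+ 2)
    + q2 * (x * y) * (p1 * (x + y) + p2 * (x * y))) by ring.
have p32 : 0 <= p3 * (2 - x * y) by rewrite mulr_ge0 ?subr_ge0.
have p1_ge0 : 0 <= p1 by lra.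
have x0' := ltW x0; have q0' := ltW q0_gt0.
have q2' := ltW q2_gt0; have p0' := ltW p0_gt0.
apply: mulr_gt0; first by rewrite subr_gt0.
do 4 (apply: ltr_wpDr; first by nonneg).
exact: mulr_gt0.
Qed.

(** Expanded in powers of L, the difference has positive coefficients because
    x^2 <= 2. *)
Lemma chord_ratio_lower L x : 0 < L -> 0 < x -> x ^+ 2 <= 2 ->
  (1 + x) * (2 + x) * L ^+ 3 * (1 + L) * (x * chord_den L x) < chord_num L x.
Proof.
move=> L0 x0 x2; rewrite -subr_gt0.
have -> : chord_num L x - (1 + x) * (2 + x) * L ^+ 3 * (1 + L) * (x * chord_den L x) =
  L * (128 + 192 * x + 96 * x ^+ 2 + 16 * x ^+ 3
  + L * (384 + 640 * x + 352 * x ^+ 2 + 64 * x ^+ 3)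
  + L ^+ 2 * (448 + 784 * x + 402 * x ^+ 2 + 52 * x ^+ 3
      + (11 * x ^+ 2 + x ^+ 3) * (2 - x ^+ 2))
  + L ^+ 3 * (256 + 426 * x + 172 * x ^+ 2
      + (15 * x + 22 * x ^+ 2 + 2 * x ^+ 3) * (2 - x ^+ 2))
  + L ^+ 4 * (72 + 76 * x + 18 * x ^+ 2 + (26 * x + 13 * x ^+ 2 + x ^+ 3) * (2 - x ^+ 2))
  + L ^+ 5 * (4 + 2 * x + (2 + 6 * x + 2 * x ^+ 2) * (2 - x ^+ 2)))
  by rewrite /chord_num /chord_den; ring.
have x2' : 0 <= 2 - x ^+ 2 by rewrite subr_ge0.
have xk k : 0 <= x ^+ k by rewrite exprn_ge0 // ltW.
have Lk k : 0 <= L ^+ k by rewrite exprn_ge0 // ltW.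
have x0' := ltW x0; have L0' := ltW L0.
apply: mulr_gt0; first exact: L0.
do 8 (apply: ltr_wpDr; first by nonneg).
by rewrite ltr0n.
Qed.

Definition sqrtT M t : R := (M - 1) ^+ 2 * t / curve_den M t.

Lemma curve_den_gt0 M t : 0 < M -> 0 < t -> 0 < curve_den M t.
Proof. by move=> M0 t0; rewrite mulr_gt0 ?addr_gt0 ?mulr_gt0. Qed.

Lemma Tfun_sqr M t : 0 < M -> 0 < t -> Tfun M t = sqrtT M t ^+ 2.
Proof.
move=> M0 t0; have := mulr_gt0 M0 t0 => Mt.
by rewrite /Tfun /sqrtT /curve_den; field; rewrite !gt_eqF //; lra.
Qed.

Lemma sqrtT_ge0 M t : 0 < M -> 0 < t -> 0 <= sqrtT M t.
Proof.
move=> M0 t0; rewrite /sqrtT divr_ge0 ?(ltW (curve_den_gt0 _ _)) //.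
by rewrite mulr_ge0 ?sqr_ge0 // ltW.
Qed.

Lemma sqrtT_nincr M t z : 0 < M -> 1 <= t -> t <= z -> sqrtT M z <= sqrtT M t.
Proof.
move=> M0 t1 tz; have [t0 z0] : 0 < t /\ 0 < z by split; lra.
rewrite /sqrtT ler_pdivrMr ?curve_den_gt0 // [leRHS]mulrAC ler_pdivlMr ?curve_den_gt0 //.
have h : 0 <= (M - 1) ^+ 2 * (M * (z - t) * (t * z - 1)).
  apply: mulr_ge0; first exact: sqr_ge0.
  by apply: mulr_ge0; [apply: mulr_ge0; lra|nra].
rewrite -subr_ge0; apply: le_trans h _.
by le_by_eq; rewrite /curve_den; ring.
Qed.

End Chord.

Section Crossing.
Context (R : realType) (M z : R).
Hypotheses (M1 : 1 < M) (z1 : 1 < z) (zM : M * z ^+ 2 = (2 * M - 2) * z + M).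

(** The value of g where the errors attained at the points 1 and z of the
    curve coincide; gammastar is the case z = ahat. *)
Definition crossing : R := (Ufun M z - Ufun M 1) / (Tfun M 1 - Tfun M z).

Lemma zsqr_le2 : (z - 1) ^+ 2 <= 2.
Proof. by have [D0 _] := hedging_curvature M1 z1 zM; have z1' := z1; nra. Qed.

Lemma z_le_M : z <= M.
Proof.
have [D0 ->] := hedging_curvature M1 z1 zM; rewrite ler_pdivlMr //.
have : 0 <= z * (z - 1) ^+ 2 by rewrite mulr_ge0 ?sqr_ge0 //; have := z1; lra.
lra.
Qed.

Let M0 : 0 < M. Proof. exact: lt_trans M1. Qed.
Let z0 : 0 < z. Proof. exact: lt_trans z1. Qed.

Lemma chord_den_gt0 L x : 0 < L -> 0 <= x -> 0 < chord_den L x :> R.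
Proof.
move=> L0 x0; apply: ltr_wpDr; first by nonneg.
by rewrite !mulr_gt0 ?exprn_gt0 //; lra.
Qed.

Lemma Tfun_lt t : 1 < t -> Tfun M t < Tfun M 1.
Proof.
move=> t1; have t0 : 0 < t by exact: lt_trans t1.
have L0 : 0 < M - 1 by rewrite subr_gt0.
rewrite -subr_gt0 Tfun_gap // divr_gt0 //; last first.
  by rewrite mulr_gt0 ?exprn_gt0 ?curve_den_gt0 ?addr_gt0.
by rewrite !mulr_gt0 ?exprn_gt0 ?subr_gt0 ?chord_den_gt0 // subr_ge0 ltW.
Qed.

Lemma V_crossing : crossing * Tfun M z + Ufun M z = crossing * Tfun M 1 + Ufun M 1.
Proof.
have h : Tfun M 1 - Tfun M z != 0 by rewrite gt_eqF // subr_gt0 Tfun_lt.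
have E : crossing * (Tfun M 1 - Tfun M z) = Ufun M z - Ufun M 1 by rewrite mulfVK.
lra.
Qed.

(** At the crossing value, moving along the curve between 1 and z costs more
    than either end, because the ratio of the gap of U to the gap of T
    decreases. *)
Lemma above_chord t : 1 < t -> t < z ->
  crossing * Tfun M 1 + Ufun M 1 < crossing * Tfun M t + Ufun M t.
Proof.
move=> t1 tz; have t0 : 0 < t by exact: lt_trans t1.
have L0 : 0 < M - 1 by rewrite subr_gt0.
have Tz : 0 < Tfun M 1 - Tfun M z by rewrite subr_gt0 Tfun_lt.
have x0 : 0 < t - 1 by rewrite subr_gt0. have y0 : 0 < z - 1 by rewrite subr_gt0.
suff : crossing * (Tfun M 1 - Tfun M t) < Ufun M t - Ufun M 1 by lra.
rewrite /crossing mulrAC ltr_pdivrMr // Tfun_gap // Tfun_gap // !Ufun_gap //.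
have C0 : 0 < (M + 1) ^+ 4 by rewrite exprn_gt0 // addr_gt0.
have D0 : 0 < curve_den M t ^+ 2 by rewrite exprn_gt0 // curve_den_gt0.
have E0 : 0 < curve_den M z ^+ 2 by rewrite exprn_gt0 // curve_den_gt0.
have := @chord_ratio_decreasing R (M - 1) (t - 1) (z - 1) L0 x0 _ zsqr_le2.
rewrite ltrD2r => /(_ tz).
move: (chord_num _ _) (chord_num _ _) (chord_den _ _) (chord_den _ _) => P' Q P Q' h.
have k0 : 0 < (M - 1) ^+ 4 * M * (t - 1) * (z - 1) /
   ((M + 1) ^+ 4 * curve_den M t ^+ 2 * ((M + 1) ^+ 4 * curve_den M z ^+ 2)).
  by apply: divr_gt0; positive.
rewrite -subr_gt0; rewrite -subr_gt0 in h.
apply: lt_le_trans (mulr_gt0 k0 h) _; le_by_eq.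
by field; rewrite !gt_eqF ?curve_den_gt0 ?addr_gt0.
Qed.

(** At the crossing value, the contraction matters so much compared with the
    noise that the quadratic of curvature 1 calls for first steps beyond the
    curve; see below_curve_gain. *)
Lemma crossing_gt : z * (z + 1) < crossing * (M - 1).
Proof.
have L0 : 0 < M - 1 by rewrite subr_gt0.
have Tz : 0 < Tfun M 1 - Tfun M z by rewrite subr_gt0 Tfun_lt.
have y0 : 0 < z - 1 by rewrite subr_gt0.
rewrite /crossing mulrAC ltr_pdivlMr // Tfun_gap // Ufun_gap //.
have C0 : 0 < (M + 1) ^+ 4 by rewrite exprn_gt0 // addr_gt0.
have E0 : 0 < curve_den M z ^+ 2 by rewrite exprn_gt0 // curve_den_gt0.
have := chord_ratio_lower L0 y0 zsqr_le2.
move: (chord_num _ _) (chord_den _ _) => P Q h.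
have k0 : 0 < (M - 1) * (z - 1) / ((M + 1) ^+ 4 * curve_den M z ^+ 2).
  by apply: divr_gt0; positive.
rewrite -subr_gt0; rewrite -subr_gt0 in h.
apply: lt_le_trans (mulr_gt0 k0 h) _; le_by_eq.
by field; rewrite !gt_eqF ?curve_den_gt0 ?addr_gt0.
Qed.

End Crossing.

(** * A short step followed by a long one *)

Section Curve.
Context (R : realType).
Implicit Types (M a b c t : R).

(** The curve 1/a + 1/b = M + 1, along which the quadratics of curvature 1
    and M contract equally over the two steps. The parameter t is the ratio
    (M b - 1) / (1 - b), equal to (1 - a) / (M a - 1); t = 1 is the pair of
    equal steps. *)
Definition curve_a M t : R := (t + 1) / (M * t + 1).
Definition curve_b M t : R := (t + 1) / (t + M).

Lemma curveE M t : 1 < M -> 0 < t ->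
  [/\ 1 - curve_a M t = (M - 1) * t / (M * t + 1),
      M * curve_a M t - 1 = (M - 1) / (M * t + 1),
      1 - curve_b M t = (M - 1) / (t + M)
    & M * curve_b M t - 1 = (M - 1) * t / (t + M)].
Proof.
move=> M1 t0; have Mt : 0 < M * t by rewrite mulr_gt0 //; lra.
by rewrite /curve_a /curve_b; split; field; rewrite gt_eqF //; lra.
Qed.

Lemma curve_sqrtT M t : 1 < M -> 0 < t ->
  (1 - curve_a M t) * (1 - curve_b M t) = sqrtT M t /\
  (M * curve_a M t - 1) * (M * curve_b M t - 1) = sqrtT M t.
Proof.
move=> M1 t0; have Mt : 0 < M * t by rewrite mulr_gt0 //; lra.
have [-> -> -> ->] := curveE M1 t0; rewrite /sqrtT /curve_den.
by split; field; rewrite !gt_eqF //; lra.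
Qed.

Lemma curve_noise M t : 1 < M -> 0 < t ->
  noise_term (curve_a M t) (curve_b M t) M = Ufun M t.
Proof.
move=> M1 t0; have Mt : 0 < M * t by rewrite mulr_gt0 //; lra.
rewrite /noise_term /curve_a /curve_b /Ufun; field.
by rewrite !gt_eqF //; lra.
Qed.

Lemma curve_at1 M : 1 < M -> curve_a M 1 = alphabar M /\ curve_b M 1 = alphabar M.
Proof. by move=> M1; rewrite /curve_a /curve_b /alphabar mulr1 [M + 1]addrC. Qed.

Lemma curve_b_onto M b : 1 < M -> alphabar M <= b -> b < 1 ->
  exists2 t, 1 <= t & b = curve_b M t.
Proof.
move=> M1 bb b1; have b0 : 0 < 1 - b by rewrite subr_gt0.
have Mb : 2 <= b * (M + 1) by move: bb; rewrite /alphabar ler_pdivrMr //; lra.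
exists ((M * b - 1) / (1 - b)); first by rewrite ler_pdivlMr //; lra.
rewrite /curve_b; have -> : (M * b - 1) / (1 - b) + 1 = (M - 1) * b / (1 - b).
  by field; rewrite gt_eqF.
have -> : (M * b - 1) / (1 - b) + M = (M - 1) / (1 - b) by field; rewrite gt_eqF.
by field; rewrite !gt_eqF //; lra.
Qed.

Lemma curve_a_onto M a : 1 < M -> 1 < M * a -> a <= alphabar M ->
  exists2 t, 1 <= t & a = curve_a M t.
Proof.
move=> M1 Ma aa; have a0 : 0 < M * a - 1 by rewrite subr_gt0.
have Mb : a * (M + 1) <= 2 by move: aa; rewrite /alphabar ler_pdivlMr //; lra.
exists ((1 - a) / (M * a - 1)); first by rewrite ler_pdivlMr //; lra.
rewrite /curve_a; have -> : (1 - a) / (M * a - 1) + 1 = (M - 1) * a / (M * a - 1).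
  by field; rewrite gt_eqF.
have -> : M * ((1 - a) / (M * a - 1)) + 1 = (M - 1) / (M * a - 1).
  by field; rewrite gt_eqF.
by field; rewrite !gt_eqF //; lra.
Qed.

Lemma curve_a_le M s t : 1 < M -> 0 < s -> 0 < t ->
  (curve_a M s <= curve_a M t) = (t <= s).
Proof.
move=> M1 s0 t0; have Mt : 0 < M * t by rewrite mulr_gt0 //; lra.
have Ms : 0 < M * s by rewrite mulr_gt0 //; lra.
rewrite /curve_a ler_pdivrMr; last lra.
rewrite mulrAC ler_pdivlMr; last lra.
rewrite -subr_ge0.
have -> : (t + 1) * (M * s + 1) - (s + 1) * (M * t + 1) = (M - 1) * (s - t) by ring.
by rewrite pmulr_rge0 ?subr_ge0 // subr_gt0.
Qed.

Lemma curve_b_le M s t : 1 < M -> 0 < s -> 0 < t ->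
  (curve_b M s <= curve_b M t) = (s <= t).
Proof.
move=> M1 s0 t0; rewrite /curve_b ler_pdivrMr; last lra.
rewrite mulrAC ler_pdivlMr; last lra.
rewrite -subr_ge0.
have -> : (t + 1) * (s + M) - (s + 1) * (t + M) = (M - 1) * (t - s) by ring.
by rewrite pmulr_rge0 ?subr_ge0 // subr_gt0.
Qed.

Lemma long_step_dominates M t b : 1 < M -> 1 <= t -> t <= M -> curve_b M t <= b ->
  0 <= M * curve_b M t - 1 /\ (t * (1 - b)) ^+ 2 <= (M * b - 1) ^+ 2.
Proof.
move=> M1 t1 tM tb; have t0 : 0 < t by lra.
have [_ _ e1 e2] := curveE M1 t0.
have m0 : 0 <= M * curve_b M t - 1.
  by rewrite e2 divr_ge0 ?mulr_ge0 ?subr_ge0 ?addr_ge0 // ltW //; lra.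
split=> //; have e3 : M * curve_b M t - 1 = t * (1 - curve_b M t).
  by rewrite e1 e2 mulrCA mulrA.
have k1 : 0 <= (b - curve_b M t) * (t + M) by rewrite mulr_ge0 ?subr_ge0 //; lra.
have k0 : 0 <= (M * b - 1) - t * (1 - b).
  by apply: le_trans k1 _; le_by_eq; lra.
have k3 : 0 <= (b - curve_b M t) * M by rewrite mulr_ge0 ?subr_ge0 //; lra.
have k2 : 0 <= (M * b - 1) + t * (1 - b).
  case: (leP b 1) => b1.
    have : 0 <= t * (1 - b) by rewrite mulr_ge0 ?subr_ge0 // ltW.
    lra.
  have : 0 <= (M - t) * (b - 1) by rewrite mulr_ge0 ?subr_ge0 // ltW.
  lra.
by rewrite -subr_ge0 subr_sqr mulr_ge0.
Qed.

End Curve.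

Section Quadrant.
Context (R : realType) (M z : R).
Hypotheses (M1 : 1 < M) (z1 : 1 < z) (zM : M * z ^+ 2 = (2 * M - 2) * z + M).
Implicit Types a b c t : R.

Let gs := crossing M z.
Let M0 : 0 < M. Proof. exact: lt_trans M1. Qed.
Let z0 : 0 < z. Proof. exact: lt_trans z1. Qed.

Definition hard_coef a b c : Prop :=
  [\/ c = (1 - a) * (1 - b), c = (1 - a * M) * (1 - b * M)
    | [/\ 0 <= a, a <= 1 & c = (1 - a) * (1 - b * M) / (1 + a * (M - 1))]].

(** A bound c^2 g + noise is affine in g, as are the values of the two
    candidate pairs. Therefore c is only required to be good at g = gamma2,
    which the third clause ensures, at the crossing value, and in slope. *)
Definition quadrant_witness a b c : Prop :=
  [/\ hard_coef a b c, Tfun M z <= c ^+ 2,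
      ((1 - a) * (1 - b)) ^+ 2 <= c ^+ 2,
      V3 M gs <= c ^+ 2 * gs + noise_term a b M
    & c ^+ 2 * gs + noise_term a b M = V3 M gs ->
      (a, b) = (alphabar M, alphabar M) \/ (a, b) = (curve_a M z, curve_b M z)].

Lemma gs_gt0 : 0 < gs.
Proof.
have := crossing_gt M1 z1 zM; rewrite -/gs => h.
have L0 : 0 < M - 1 by rewrite subr_gt0.
rewrite -(pmulr_lgt0 _ L0); apply: le_lt_trans h.
by rewrite mulr_ge0 ?addr_ge0 // ltW.
Qed.

Lemma chord_le t : 1 <= t -> t <= z ->
  V3 M gs <= Tfun M t * gs + Ufun M t /\
  (Tfun M t * gs + Ufun M t = V3 M gs -> t = 1 \/ t = z).
Proof.
rewrite le_eqVlt => /orP[/eqP <- _|t1]; first by rewrite /V3 [gs * _]mulrC; split; [|left].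
rewrite le_eqVlt => /orP[/eqP ->|tz].
  by rewrite /V3 [_ * gs]mulrC (V_crossing M1 z1); split; [|right].
have := above_chord M1 z1 zM t1 tz; rewrite -/gs -/(V3 M gs) [gs * Tfun M t]mulrC => h.
by split; [exact: ltW | move=> e; move: h; rewrite e ltxx].
Qed.

Lemma curve_sqr_ge t c : 1 <= t -> t <= z -> sqrtT M t <= `|c| -> Tfun M z <= c ^+ 2.
Proof.
move=> t1 tz tc; rewrite Tfun_sqr // -[c ^+ 2]real_normK ?num_real //.
have zt := sqrtT_nincr M0 t1 tz.
rewrite lerXn2r ?nnegrE ?sqrtT_ge0 //; exact: le_trans tc.
Qed.

(** Below the curve: lengthening the first step decreases the error of the
    quadratic of curvature 1 until the curve is reached, by crossing_gt. *)
Lemma below_curve_gain t a : 1 <= t -> t <= z -> a <= curve_a M t ->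
  Tfun M t * gs + Ufun M t + (1 - curve_b M t) ^+ 2 * (curve_a M t - a) ^+ 2 * t ^+ 2
  <= ((1 - a) * (1 - curve_b M t)) ^+ 2 * gs + noise_term a (curve_b M t) M.
Proof.
move=> t1 tz at_; have t0 : 0 < t by lra.
have [e1 e2 e3 e4] := curveE M1 t0.
have [s1 _] := curve_sqrtT M1 t0.
rewrite Tfun_sqr // -s1 -(curve_noise M1 t0) /noise_term.
have e5 : curve_b M t * M = t * (1 - curve_b M t) + 1.
  by rewrite e3 mulrCA mulrA -e4 mulrC subrK.
rewrite e5; move: (curve_b M t) => b.
have k1 : 0 <= gs * (1 - curve_a M t) - t ^+ 2 * curve_a M t.
  have L0 : 0 < M - 1 by rewrite subr_gt0.
  have Mt : 0 < M * t + 1 by rewrite addr_gt0 // mulr_gt0.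
  rewrite e1 /curve_a.
  have -> : gs * ((M - 1) * t / (M * t + 1)) - t ^+ 2 * ((t + 1) / (M * t + 1)) =
     t * (gs * (M - 1) - t * (t + 1)) / (M * t + 1) by field; rewrite gt_eqF.
  rewrite divr_ge0 ?(ltW Mt) // mulr_ge0 ?(ltW t0) // subr_ge0.
  apply: le_trans (ltW (crossing_gt M1 z1 zM)).
  by apply: ler_pM; lra.
move: (curve_a M t) at_ k1 => c ac k1.
rewrite -subr_ge0.
have -> : ((1 - a) * (1 - b)) ^+ 2 * gs + (a ^+ 2 * (1 - (t * (1 - b) + 1)) ^+ 2 + b ^+ 2)
  - (((1 - c) * (1 - b)) ^+ 2 * gs + (c ^+ 2 * (1 - (t * (1 - b) + 1)) ^+ 2 + b ^+ 2)
  + (1 - b) ^+ 2 * (c - a) ^+ 2 * t ^+ 2) =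
  (1 - b) ^+ 2 * ((c - a) * (2 * (gs * (1 - c) - t ^+ 2 * c) + gs * (c - a))) by ring.
have d0 : 0 <= c - a by rewrite subr_ge0.
have g0 := ltW gs_gt0.
apply: mulr_ge0; first exact: sqr_ge0.
by apply: mulr_ge0 => //; apply: addr_ge0; apply: mulr_ge0.
Qed.

Lemma below_curve t a : 1 <= t -> t <= z -> 0 <= a -> a <= curve_a M t ->
  quadrant_witness a (curve_b M t) ((1 - a) * (1 - curve_b M t)).
Proof.
move=> t1 tz a0 at_; have t0 : 0 < t by lra.
have L0 : 0 < M - 1 by rewrite subr_gt0.
have gain := below_curve_gain t1 tz at_.
have [cl ce] := chord_le t1 tz.
have [e1 e2 e3 e4] := curveE M1 t0.
have b0 : 0 < 1 - curve_b M t by rewrite e3 divr_gt0 // addr_gt0.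
have c0 : 0 <= 1 - curve_a M t.
  by rewrite e1; apply: divr_ge0; nonneg.
have k0 : 0 <= (1 - curve_b M t) ^+ 2 * (curve_a M t - a) ^+ 2 * t ^+ 2.
  by rewrite -!exprMn sqr_ge0.
split=> //; first exact: Or31.
- apply: (curve_sqr_ge t1 tz); have [<- _] := curve_sqrtT M1 t0.
  rewrite ger0_norm; last by rewrite mulr_ge0 ?(ltW b0) //; lra.
  by rewrite ler_wpM2r ?(ltW b0) //; lra.
- by apply: le_trans gain; lra.
move=> e; have ae : a = curve_a M t.
  have /eqP : (1 - curve_b M t) ^+ 2 * (curve_a M t - a) ^+ 2 * t ^+ 2 = 0 by lra.
  rewrite -!exprMn sqrf_eq0 !mulf_eq0 (gt_eqF b0) (gt_eqF t0) orbF subr_eq0 /=.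
  by move=> /eqP.
have /ce ee : Tfun M t * gs + Ufun M t = V3 M gs by apply/eqP; rewrite eq_le cl andbT; lra.
by rewrite ae; case: ee => ->; [left; have [-> ->] := curve_at1 M1|right].
Qed.

(** Above the curve: shortening the second step decreases the error of the
    quadratic of curvature M until the curve is reached. *)
Lemma above_curve t b : 1 <= t -> t <= z -> curve_b M t <= b ->
  quadrant_witness (curve_a M t) b ((1 - curve_a M t * M) * (1 - b * M)).
Proof.
move=> t1 tz tb; have t0 : 0 < t by lra.
have [e1 e2 e3 e4] := curveE M1 t0.
have L0 : 0 < M - 1 by rewrite subr_gt0.
have [cl ce] := chord_le t1 tz.
have tM : t <= M := le_trans tz (z_le_M M1 z1 zM).
have [m0 dom] := long_step_dominates M1 t1 tM tb.
have bM : M * curve_b M t - 1 <= M * b - 1 by rewrite lerB // ler_wpM2l // ltW.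
have a0 : 0 <= M * curve_a M t - 1.
  by rewrite e2; apply: divr_ge0; nonneg.
have [_ s2] := curve_sqrtT M1 t0.
have cE : (1 - curve_a M t * M) * (1 - b * M) = (M * curve_a M t - 1) * (M * b - 1) by ring.
have sc : sqrtT M t <= (M * curve_a M t - 1) * (M * b - 1) by rewrite -s2 ler_wpM2l.
have s0 := sqrtT_ge0 M0 t0.
have sc2 : Tfun M t <= ((M * curve_a M t - 1) * (M * b - 1)) ^+ 2.
  by rewrite Tfun_sqr // lerXn2r ?nnegrE //; exact: le_trans sc.
have g0 := gs_gt0.
have b0 : 0 <= curve_b M t by rewrite /curve_b divr_ge0 ?addr_ge0 // ltW.
have nn : Ufun M t + (b ^+ 2 - curve_b M t ^+ 2) <= noise_term (curve_a M t) b M.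
  rewrite -(curve_noise M1 t0) /noise_term.
  have : curve_a M t ^+ 2 * (1 - curve_b M t * M) ^+ 2 <= curve_a M t ^+ 2 * (1 - b * M) ^+ 2.
    apply: ler_wpM2l; first exact: sqr_ge0.
    rewrite -(sqrrN (1 - _)) -(sqrrN (1 - b * M)) !opprB ![_ * M]mulrC.
    by rewrite lerXn2r ?nnegrE // (le_trans m0).
  lra.
have b2 : 0 <= b ^+ 2 - curve_b M t ^+ 2.
  by rewrite subr_ge0 lerXn2r ?nnegrE //; exact: le_trans tb.
have sg : Tfun M t * gs <= ((M * curve_a M t - 1) * (M * b - 1)) ^+ 2 * gs.
  by rewrite ler_wpM2r // ltW.
rewrite cE; split.
- by rewrite -cE; exact: Or32.
- apply: (curve_sqr_ge t1 tz); apply: le_trans sc _; exact: ler_norm.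
- have -> : 1 - curve_a M t = t * (M * curve_a M t - 1) by rewrite e1 e2; ring.
  have -> : t * (M * curve_a M t - 1) * (1 - b) = (M * curve_a M t - 1) * (t * (1 - b)) by ring.
  by rewrite !exprMn; apply: ler_wpM2l; [exact: sqr_ge0|rewrite -exprMn].
- by lra.
move=> e; have be : b = curve_b M t.
  have : b ^+ 2 - curve_b M t ^+ 2 = 0 by lra.
  move=> /eqP; rewrite subr_eq0 eqrXn2 // => [/eqP //|]; exact: le_trans tb.
have /ce ee : Tfun M t * gs + Ufun M t = V3 M gs by apply/eqP; rewrite eq_le cl andbT; lra.
by rewrite be; case: ee => ->; [left; have [-> ->] := curve_at1 M1|right].
Qed.
End Quadrant.

Section QuadrantBound.
Context (R : realType) (M z : R).
Hypotheses (M1 : 1 < M) (z1 : 1 < z) (zM : M * z ^+ 2 = (2 * M - 2) * z + M).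
Implicit Types a b c t g W : R.

Let gs := crossing M z.
Let M0 : 0 < M. Proof. exact: lt_trans M1. Qed.
Let z0 : 0 < z. Proof. exact: lt_trans z1. Qed.

(** Reducing the second step to its hedged value decreases both the
    half-Huber contraction and the noise; there, this contraction dominates
    that of the quadratic of curvature 1, and below_curve applies. *)
Lemma huber_region a b : 0 <= a -> a <= curve_a M z -> curve_b M z <= b ->
  quadrant_witness M z a b ((1 - a) * (1 - b * M) / (1 + a * (M - 1))).
Proof.
move=> a0 az bz; have L0 : 0 < M - 1 by rewrite subr_gt0.
have [e1 e2 e3 e4] := curveE M1 z0.
have Mz : 0 < M * z + 1 by rewrite addr_gt0 // mulr_gt0.
have [_ Tc _ Vc Ve] := below_curve M1 z1 zM (ltW z1) (lexx z) a0 az.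
have [m0 dom] := long_step_dominates M1 (ltW z1) (z_le_M M1 z1 zM) bz.
have La : 1 + a * (M - 1) <= z.
  have : a * (M - 1) <= curve_a M z * (M - 1) by rewrite ler_wpM2r // ltW.
  have -> : curve_a M z * (M - 1) = z - 1.
    apply: (mulIf (lt0r_neq0 Mz)); rewrite /curve_a mulrAC mulfVK ?gt_eqF //.
    have := zM; lra.
  lra.
have D0 : 0 < 1 + a * (M - 1) by apply: ltr_wpDr => //; nonneg.
have D2 : (1 + a * (M - 1)) ^+ 2 <= z ^+ 2 by rewrite lerXn2r ?nnegrE // ltW.
have bM : M * curve_b M z - 1 <= M * b - 1 by rewrite lerB // ler_wpM2l // ltW.
have zb : (z * (1 - curve_b M z)) ^+ 2 <= (M * b - 1) ^+ 2.
  have -> : z * (1 - curve_b M z) = M * curve_b M z - 1 by rewrite e3 e4 mulrCA mulrA.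
  by rewrite lerXn2r ?nnegrE //; exact: le_trans bM.
(* The overshoot of the long step beats the quadratic of curvature 1 at any second step x
   for which z |1 - x| <= M b - 1, as the first step divides it by at most z. *)
have key x : (z * (1 - x)) ^+ 2 <= (M * b - 1) ^+ 2 ->
    ((1 - a) * (1 - x)) ^+ 2 <= ((1 - a) * (1 - b * M) / (1 + a * (M - 1))) ^+ 2.
  move=> zx; rewrite -mulrA [leLHS]exprMn [leRHS]exprMn; apply: ler_wpM2l; first exact: sqr_ge0.
  rewrite expr_div_n ler_pdivlMr ?exprn_gt0 //.
  have -> : (1 - b * M) ^+ 2 = (M * b - 1) ^+ 2 by ring.
  apply: le_trans zx; rewrite exprMn mulrC; apply: ler_wpM2r => //.
  exact: sqr_ge0.
have c1 := key _ zb; have c2 := key _ dom.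
have a1 : a <= 1.
  apply: le_trans az _; rewrite -subr_ge0 e1.
  by apply: divr_ge0; nonneg.
have b0 : 0 <= curve_b M z by rewrite /curve_b; apply: divr_ge0; nonneg.
have b2 : 0 <= b ^+ 2 - curve_b M z ^+ 2.
  by rewrite subr_ge0 lerXn2r ?nnegrE //; exact: le_trans bz.
have nn : noise_term a (curve_b M z) M + (b ^+ 2 - curve_b M z ^+ 2) <= noise_term a b M.
  rewrite /noise_term.
  have : a ^+ 2 * (1 - curve_b M z * M) ^+ 2 <= a ^+ 2 * (1 - b * M) ^+ 2.
    apply: ler_wpM2l; first exact: sqr_ge0.
    rewrite -(sqrrN (1 - _)) -(sqrrN (1 - b * M)) !opprB ![_ * M]mulrC.
    by rewrite lerXn2r ?nnegrE // (le_trans m0).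
  lra.
have g0 := ltW (gs_gt0 M1 z1 zM).
have cg := ler_wpM2r g0 c1.
split=> //.
- exact: Or33.
- exact: le_trans c1.
- by rewrite -/gs in cg Vc *; lra.
move=> e; rewrite -/gs in cg Vc Ve e.
have b2e : b ^+ 2 - curve_b M z ^+ 2 = 0 by lra.
have be : b = curve_b M z.
  move: b2e => /eqP; rewrite subr_eq0 eqrXn2 // => [/eqP //|]; exact: le_trans bz.
rewrite be; apply: Ve; apply/eqP; rewrite eq_le Vc andbT; lra.
Qed.

Lemma quadrant a b : 0 <= a -> a <= alphabar M -> alphabar M <= b ->
  exists c, quadrant_witness M z a b c.
Proof.
move=> a0 aa bb; have L0 : 0 < M - 1 by rewrite subr_gt0.
have above t : 1 <= t -> t <= z -> curve_a M t < a -> curve_b M t <= b ->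
    exists c, quadrant_witness M z a b c.
  move=> t1 tz ta tb; have t0 : 0 < t by lra.
  have [_ e2 _ _] := curveE M1 t0.
  have Ma : 1 < M * a.
    rewrite -subr_gt0; have : 0 < M * (a - curve_a M t) by rewrite mulr_gt0 ?subr_gt0.
    have : 0 <= M * curve_a M t - 1.
      by rewrite e2; apply: divr_ge0; nonneg.
    lra.
  have [s s1 aE] := curve_a_onto M1 Ma aa.
  have s0 : 0 < s by lra.
  have st : s <= t by rewrite -(curve_a_le M1 t0 s0) -aE ltW.
  eexists; rewrite aE; apply: (above_curve M1 z1 zM s1 (le_trans st tz)).
  by apply: le_trans tb; rewrite curve_b_le.
case: (leP b (curve_b M z)) => bz.
  have b1 : b < 1.
    apply: le_lt_trans bz _; have [_ _ e3 _] := curveE M1 z0.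
    by rewrite -subr_gt0 e3 divr_gt0 ?subr_gt0 // addr_gt0.
  have [t t1 bE] := curve_b_onto M1 bb b1.
  have t0 : 0 < t by lra.
  have tz : t <= z by rewrite -(curve_b_le M1 t0 z0) -bE.
  case: (leP a (curve_a M t)) => at_; last by apply: (above t) => //; rewrite bE.
  by eexists; rewrite bE; exact: (below_curve M1 z1 zM).
case: (leP a (curve_a M z)) => az; first by eexists; exact: huber_region (ltW bz).
by apply: (above z) => //; exact: ltW.
Qed.

Lemma gamma2_cond g : gamma2 M <= g = (2 * (M ^+ 2 + 3) <= g * (M - 1) ^+ 3).
Proof. by rewrite /gamma2 ler_pdivrMr // exprn_gt0 // subr_gt0. Qed.

Lemma gamma1_cond g : gamma1 M <= g = (2 <= g * (M - 1)).
Proof. by rewrite /gamma1 ler_pdivrMr // subr_gt0. Qed.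

Lemma gamma12 : gamma1 M <= gamma2 M.
Proof.
have M1' := M1; have L0 : 0 < M - 1 by rewrite subr_gt0.
rewrite gamma1_cond /gamma2.
have -> : 2 * (M ^+ 2 + 3) / (M - 1) ^+ 3 * (M - 1) = 2 * (M ^+ 2 + 3) / (M - 1) ^+ 2.
  by field; rewrite gt_eqF.
by rewrite ler_pdivlMr ?exprn_gt0 //; nra.
Qed.

Lemma V12_boundary : V1 (gamma1 M) = V2 M (gamma1 M).
Proof.
have L0 : 0 < M - 1 by rewrite subr_gt0.
have h := sqr_ge0 (M - 1); have h' := sqr_ge0 (M + 1).
rewrite /V1 /V2 /gamma1; field; have M1' := M1.
by rewrite !gt_eqF //; nra.
Qed.

Lemma V2_gamma2 : V2 M (gamma2 M) = alphabar M.
Proof.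
have L0 : 0 < M - 1 by rewrite subr_gt0.
rewrite /V2 /gamma2 /alphabar; field; have M1' := M1.
by rewrite !gt_eqF //; nra.
Qed.

Lemma V23_boundary : V2 M (gamma2 M) = V3 M (gamma2 M).
Proof.
have L0 : 0 < M - 1 by rewrite subr_gt0.
rewrite V2_gamma2 V3E // /K2 /gamma2 /alphabar; field; have M1' := M1.
by rewrite !gt_eqF //; lra.
Qed.

(** Lowering c to the contraction of curvature 1, and letting the noise see
    the curvature 1 instead of M, leaves a bound which is minimal at equal
    steps when g = gamma2. *)
Lemma quadrant_gamma2 a b c : a <= alphabar M -> alphabar M <= b ->
  ((1 - a) * (1 - b)) ^+ 2 <= c ^+ 2 ->
  V3 M (gamma2 M) <= c ^+ 2 * gamma2 M + noise_term a b M /\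
  (c ^+ 2 * gamma2 M + noise_term a b M = V3 M (gamma2 M) ->
   (a, b) = (alphabar M, alphabar M)).
Proof.
move=> aa bb cB; have M1' := M1.
have gM : 2 <= gamma2 M * (M - 1) by rewrite -gamma1_cond gamma12.
have L0 : 0 < M - 1 by rewrite subr_gt0.
have g0 : 0 <= gamma2 M by rewrite ltW // -(@pmulr_lgt0 _ (M - 1)) //; lra.
have [kK kE] := short_first_step M1 gM aa.
have [h1 h2] := V2_le_second_step b M1 g0 kK.
have Mb : 0 <= b * (M + 1) - 2.
  by move: bb; rewrite /alphabar ler_pdivrMr; lra.
have b0 : 0 <= b by apply: le_trans bb; rewrite /alphabar divr_ge0 //; lra.
have n : (1 - b) ^+ 2 * a ^+ 2 + b ^+ 2 <= noise_term a b M.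
  rewrite /noise_term lerD2r mulrC; apply: ler_wpM2l; first exact: sqr_ge0.
  rewrite -subr_ge0.
  have -> : (1 - b * M) ^+ 2 - (1 - b) ^+ 2 = b * (M - 1) * (b * (M + 1) - 2) by ring.
  by apply: mulr_ge0 => //; apply: mulr_ge0 => //; exact: ltW.
have cg := ler_wpM2r g0 cB.
rewrite -V23_boundary; have E : (1 - b) ^+ 2 * ((1 - a) ^+ 2 * gamma2 M + a ^+ 2) + b ^+ 2 =
  ((1 - a) * (1 - b)) ^+ 2 * gamma2 M + ((1 - b) ^+ 2 * a ^+ 2 + b ^+ 2) by ring.
split; first by lra.
move=> e; have [|bE /kE ->] := h2; first by apply/eqP; rewrite eq_le h1 andbT; lra.
by rewrite bE V2_gamma2.
Qed.

(** At gamma2 the equal steps are strictly better than the hedged ones, by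
    quadrant_gamma2. *)
Lemma gamma2_lt_crossing : gamma2 M < gs.
Proof.
have M1' := M1; have z1' := z1.
have [ea eb] := curve_at1 M1.
have aa : curve_a M z <= alphabar M by rewrite -ea curve_a_le // ltW.
have bb : alphabar M <= curve_b M z by rewrite -eb curve_b_le // ltW.
have [s1 _] := curve_sqrtT M1 z0.
have [h1 h2] := quadrant_gamma2 aa bb (lexx _).
have h : V3 M (gamma2 M) < Tfun M z * gamma2 M + Ufun M z.
  rewrite s1 (curve_noise M1 z0) -Tfun_sqr // in h1 h2.
  rewrite lt_neqAle h1 andbT; apply/eqP => e; have := h2 (esym e).
  move=> [/eqP]; rewrite eq_le -ea !curve_a_le //.
  by rewrite [z <= 1]leNgt z1 andbF.
rewrite /gs /crossing ltr_pdivlMr ?subr_gt0 ?Tfun_lt //.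
by move: h; rewrite /V3; lra.
Qed.

Lemma dominates_coef g a b c W : dominates M g a b W -> hard_coef M a b c ->
  c ^+ 2 * g + noise_term a b M <= W.
Proof.
move=> [quad _ hub] [->|->|[a0 a1 ->]].
- by have := quad 1 M (lexx 1) (ltW M1) (ltW M1) (lexx M); rewrite !mulr1.
- exact: (quad M M (ltW M1) (lexx M) (ltW M1) (lexx M)).
- exact: (hub M a0 a1 (ltW M1) (lexx M)).
Qed.

(** V4 is the case z = ahat. *)
Definition hedged_value g : R := g * Tfun M z + Ufun M z.

Lemma V34_gap g : V3 M g - hedged_value g = (g - gs) * (Tfun M 1 - Tfun M z).
Proof.
have := V_crossing M1 z1; rewrite -/gs /V3 /hedged_value => e.
have -> : (g - gs) * (Tfun M 1 - Tfun M z) =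
   g * Tfun M 1 - g * Tfun M z + (gs * Tfun M z - gs * Tfun M 1) by ring.
lra.
Qed.

(** Interpolate between gamma2 and the crossing value. *)
Lemma quadrant_le_V3 g a b W : gamma2 M <= g -> g <= gs ->
  0 <= a -> a <= alphabar M -> alphabar M <= b -> dominates M g a b W ->
  V3 M g <= W /\
  (W = V3 M g -> (a, b) = (alphabar M, alphabar M) \/
                 g = gs /\ (a, b) = (curve_a M z, curve_b M z)).
Proof.
move=> g2 ggs a0 aa bb dom; have [c [cH Tc Bc Vc Ve]] := quadrant a0 aa bb.
have cW := dominates_coef dom cH.
have [h2 e2] := quadrant_gamma2 aa bb Bc.
rewrite -/gs in Vc Ve.
have lt := gamma2_lt_crossing.
have E x : c ^+ 2 * x + noise_term a b M - V3 M x =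
   (c ^+ 2 - Tfun M 1) * x + (noise_term a b M - Ufun M 1) by rewrite /V3; ring.
have I : (gs - gamma2 M) * (c ^+ 2 * g + noise_term a b M - V3 M g) =
  (gs - g) * (c ^+ 2 * gamma2 M + noise_term a b M - V3 M (gamma2 M)) +
  (g - gamma2 M) * (c ^+ 2 * gs + noise_term a b M - V3 M gs).
  by rewrite !E; ring.
have p1 : 0 <= (gs - g) * (c ^+ 2 * gamma2 M + noise_term a b M - V3 M (gamma2 M)).
  by rewrite mulr_ge0 // subr_ge0.
have p2 : 0 <= (g - gamma2 M) * (c ^+ 2 * gs + noise_term a b M - V3 M gs).
  by rewrite mulr_ge0 // subr_ge0.
have l0 : 0 < gs - gamma2 M by rewrite subr_gt0.
have V : V3 M g <= c ^+ 2 * g + noise_term a b M.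
  by rewrite -subr_ge0 -(pmulr_rge0 _ l0) I addr_ge0.
split; first exact: le_trans cW.
move=> We; have F0 : c ^+ 2 * g + noise_term a b M - V3 M g = 0.
  by apply/eqP; rewrite subr_eq0 eq_le V andbT -We.
rewrite F0 mulr0 in I.
move: ggs; rewrite le_eqVlt => /orP[/eqP gE|glt].
  have Fgs : c ^+ 2 * gs + noise_term a b M = V3 M gs.
    by rewrite -gE; apply/eqP; rewrite -subr_eq0 F0.
  by have [->|->] := Ve Fgs; [left | right].
left; apply: e2; apply/eqP; rewrite -subr_eq0.
have /eqP : (gs - g) * (c ^+ 2 * gamma2 M + noise_term a b M - V3 M (gamma2 M)) = 0 by lra.
by rewrite mulf_eq0 gt_eqF ?subr_gt0.
Qed.

(** Extrapolate beyond the crossing value with the slope of the hedged pair. *)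
Lemma quadrant_le_V4 g a b W : gs <= g ->
  0 <= a -> a <= alphabar M -> alphabar M <= b -> dominates M g a b W ->
  hedged_value g <= W /\
  (W = hedged_value g -> g = gs /\ (a, b) = (alphabar M, alphabar M) \/
                (a, b) = (curve_a M z, curve_b M z)).
Proof.
move=> ggs a0 aa bb dom; have [c [cH Tc Bc Vc Ve]] := quadrant a0 aa bb.
have cW := dominates_coef dom cH.
rewrite -/gs in Vc Ve.
have Vgs : V3 M gs = hedged_value gs by apply/eqP; rewrite -subr_eq0 V34_gap subrr mul0r.
have p : 0 <= (c ^+ 2 - Tfun M z) * (g - gs) by rewrite mulr_ge0 // subr_ge0.
have E : c ^+ 2 * g + noise_term a b M - hedged_value g = (c ^+ 2 - Tfun M z) * (g - gs) +
   (c ^+ 2 * gs + noise_term a b M - hedged_value gs) by rewrite /hedged_value; ring.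
split; first by lra.
move=> We; have /Ve [ab|->] : c ^+ 2 * gs + noise_term a b M = V3 M gs.
- by apply/eqP; rewrite eq_le Vc andbT; lra.
- left; split=> //; apply/eqP; rewrite eq_le ggs andbT.
  have g0 : 0 <= g by apply: le_trans ggs; exact: ltW (gs_gt0 M1 z1 zM).
  case: ab => aE bE; rewrite aE bE in dom.
  have [V3W _] := V3_le_long M1 g0 (lexx _) (lexx _) dom.
  have T0 : 0 < Tfun M 1 - Tfun M z by rewrite subr_gt0 Tfun_lt.
  rewrite -subr_le0 -(pmulr_lle0 _ T0) -V34_gap; lra.
- by right.
Qed.

End QuadrantBound.

(** * Conclusion *)

Section HedgingPoint.
Context (R : realType) (M : R).
Hypothesis M1 : 1 < M.

Lemma etaM_sqr : etaM M ^+ 2 = 2 * M ^+ 2 - 2 * M + 1.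
Proof. by rewrite /etaM sqr_sqrtr //; have := M1; nra. Qed.

Lemma etaM_bounds : 1 < etaM M /\ etaM M < 2 * M.
Proof.
have M1' := M1; have e0 : 0 <= etaM M by exact: sqrtr_ge0.
split; rewrite -(@ltr_pXn2r _ 2) // ?nnegrE ?etaM_sqr //; nra.
Qed.

Lemma ahat_gt1 : 1 < ahat M.
Proof. by have [e1 _] := etaM_bounds; rewrite /ahat ltr_pdivlMr; have := M1; lra. Qed.

Lemma ahatE : M * ahat M = M - 1 + etaM M.
Proof. by rewrite /ahat mulrC mulfVK // gt_eqF // (lt_trans ltr01). Qed.

Lemma ahat_hedging : M * ahat M ^+ 2 = (2 * M - 2) * ahat M + M.
Proof.
have M0 : M != 0 by rewrite gt_eqF // (lt_trans ltr01).
apply: (mulfI M0); rewrite mulrA -expr2 -exprMn ahatE mulrDr.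
have -> : M * ((2 * M - 2) * ahat M) = (2 * M - 2) * (M * ahat M) by ring.
rewrite ahatE; have := etaM_sqr; move: (etaM M) => e he.
have -> : (M - 1 + e) ^+ 2 = (M - 1) ^+ 2 + 2 * (M - 1) * e + e ^+ 2 by ring.
by rewrite he; ring.
Qed.

(** Both sides are rational in ahat, as etaM = M ahat - M + 1. *)
Lemma hedging_point :
  (2 / (1 + etaM M), 2 / (1 + 2 * M - etaM M)) = (curve_a M (ahat M), curve_b M (ahat M)).
Proof.
have M1' := M1; have [e1 e2] := etaM_bounds; have he := etaM_sqr.
have M0 : M != 0 by rewrite gt_eqF //; lra.
have z1 := ahat_gt1; have zE := ahatE.
have k1 : M * ahat M + 1 != 0 by rewrite zE gt_eqF //; lra.
have k2 : ahat M + M != 0 by rewrite gt_eqF //; lra.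
have k3 : 1 + etaM M != 0 by rewrite gt_eqF //; lra.
have k4 : 1 + 2 * M - etaM M != 0 by rewrite gt_eqF //; lra.
have eE : etaM M = M * ahat M - M + 1 by rewrite zE; ring.
have hz := ahat_hedging.
rewrite /curve_a /curve_b; congr (_, _); apply/eqP; rewrite eqr_div // eE; apply/eqP; lra.
Qed.

End HedgingPoint.

Section Optimum.
Context (R : realType).
Implicit Types (M g a b W : R).

Lemma Vstar_le M g a b W : 1 < M -> 0 <= g -> 0 <= a -> 0 <= b -> dominates M g a b W ->
  Vstar M g <= W /\
  (W = Vstar M g -> (a, b) = schedule M g \/
                    g = gammastar M /\ (a, b) = (alphabar M, alphabar M)).
Proof.
move=> M1 g0 a0 b0 dom; have M0 : 0 < M by lra.
have hz := ahat_hedging M1; have z1 := ahat_gt1 M1.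
rewrite /Vstar /schedule hedging_point //.
case: (leP g (gamma1 M)) => [g1|g1].
  by have [h e] := V1_le M1 g0 dom; split=> // /e ->; left.
have gM : 2 <= g * (M - 1) by rewrite -gamma1_cond // ltW.
case: (leP g (gamma2 M)) => [g2|g2].
  by have [h e] := V2_le M1 gM a0 dom; split=> // /e ->; left.
have gap := V34_gap M1 z1 g.
rewrite -[hedged_value _ _ g]/(V4 M g) -[crossing _ _]/(gammastar M) in gap.
have T0 : 0 < Tfun M 1 - Tfun M (ahat M) by rewrite subr_gt0 Tfun_lt.
have gM2 : 2 * (M ^+ 2 + 3) <= g * (M - 1) ^+ 3 by rewrite -gamma2_cond // ltW.
(* Outside the quadrant of a short step followed by a long one the value is at
   least V3, which exceeds V4 beyond the crossing. *)
have out : V3 M g <= W /\ (W = V3 M g -> (a, b) = (alphabar M, alphabar M)) ->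
    (if g <= gammastar M then V3 M g else V4 M g) <= W /\
    (W = (if g <= gammastar M then V3 M g else V4 M g) ->
     (a, b) = (if g < gammastar M then (alphabar M, alphabar M)
               else (curve_a M (ahat M), curve_b M (ahat M))) \/
     g = gammastar M /\ (a, b) = (alphabar M, alphabar M)).
  move=> [h e]; case: (ltgtP g (gammastar M)) => gg.
  - by split=> // /e ->; left.
  - have : 0 < V3 M g - V4 M g by rewrite gap mulr_gt0 // subr_gt0.
    by move=> d; split; [lra | move=> We; exfalso; lra].
  - by split=> // /e ->; right.
case: (leP b (alphabar M)) => bb; first by apply: out; exact: V3_le_short.
case: (leP (alphabar M) a) => aa.
  by apply: out; apply: (V3_le_long M1 g0 aa (ltW bb) dom).
case: (leP g (gammastar M)) => gg.
  have [h e] := quadrant_le_V3 M1 z1 hz (ltW g2) gg a0 (ltW aa) (ltW bb) dom.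
  split=> // /e [ab|[gE ab]].
    by move: bb; case: ab => _ ->; rewrite ltxx.
  by left; rewrite ab [g]gE ltxx.
have [h e] := quadrant_le_V4 M1 z1 hz (ltW gg) a0 (ltW aa) (ltW bb) dom.
split=> // /e [[gE ab]|ab]; last by left; rewrite ltNge (ltW gg).
by move: bb; case: ab => _ ->; rewrite ltxx.
Qed.

Lemma schedule_ge0 M g : 1 < M -> 0 <= g -> stepsizes (schedule M g).
Proof.
move=> M1 g0; have M0 : 0 < M by lra.
have z0 : 0 < ahat M by rewrite (lt_trans ltr01) // ahat_gt1.
have ab : 0 <= alphabar M by rewrite /alphabar divr_ge0 //; lra.
have q : 0 <= g * (M - 1) ^+ 2 + 4 by rewrite addr_ge0 // mulr_ge0 // sqr_ge0.
rewrite /stepsizes /schedule hedging_point // /=.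
case: ifP => _ /=; first by split; apply: divr_ge0 => //; lra.
case: ifP => _ /=; first by split=> //; apply: divr_ge0 => //; rewrite addr_ge0 // sqr_ge0.
case: ifP => _ //=; split; rewrite /curve_a /curve_b; apply: divr_ge0; nonneg.
Qed.

End Optimum.

Section WorstCase.
Context (R : realType) (M rho sigma : R).
Hypotheses (M1 : 1 < M) (rho0 : 0 <= rho) (sigma0 : 0 < sigma).

Let g := rho ^+ 2 / sigma ^+ 2.
Let D := worst_case_error M rho sigma.
Let s0 : 0 < sigma ^+ 2. Proof. exact: exprn_gt0. Qed.
Let g0 : 0 <= g. Proof. by rewrite divr_ge0 ?sqr_ge0. Qed.
Let rhoE : rho ^+ 2 = g * sigma ^+ 2. Proof. by rewrite mulfVK // gt_eqF. Qed.

Lemma dominates_worst_case a b (W : R) : D (a, b) = W%:E -> dominates M g a b (W / sigma ^+ 2).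
Proof.
move=> DW.
have E c n : ((c ^+ 2 * rho ^+ 2 + n * sigma ^+ 2)%:E <= D (a, b))%E ->
    c ^+ 2 * g + n <= W / sigma ^+ 2.
  by rewrite DW lee_fin rhoE mulrA -mulrDl ler_pdivlMr.
split=> [p q p1 pM q1 qM|q Ma q1 qM|q a0 a1 q1 qM]; apply: E.
- exact: quadratic_lower_bound.
- exact: overshoot_lower_bound.
- exact: huber_lower_bound.
Qed.

Lemma worst_case_lower p : stepsizes p ->
  ((sigma ^+ 2 * Vstar M g)%:E <= D p)%E /\
  (D p = (sigma ^+ 2 * Vstar M g)%:E ->
   p = schedule M g \/ g = gammastar M /\ p = (alphabar M, alphabar M)).
Proof.
case: p => a b [/= a0 b0].
have := @quadratic_lower_bound R M rho sigma a b rho0 1 1 (lexx 1) (ltW M1) (lexx 1) (ltW M1).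
rewrite -/D; case DE : (D (a, b)) => [W| |] // _; last by rewrite leey.
have [h e] := Vstar_le M1 g0 a0 b0 (dominates_worst_case DE).
split; first by rewrite lee_fin mulrC -ler_pdivlMr.
by move=> [We]; apply: e; rewrite We [_ * Vstar _ _]mulrC mulfK // gt_eqF.
Qed.

Lemma worst_case_upper a b (V : R) :
  (forall (d : nat) (f : 'rV[R]_d -> R) (x0 xs : 'rV[R]_d) (I : finType)
     (o : 'rV[R]_d -> I -> 'rV[R]_d), strongly_convex_smooth M f -> is_minimizer f xs ->
     enorm (x0 - xs) <= rho -> is_oracle sigma f o ->
     terminal_error o a b x0 xs <= V) -> (D (a, b) <= V%:E)%E.
Proof.
move=> h; apply: ge_ereal_sup => _ [d [f [u0 [us [J [w []]]]]]] [_ fM] xm u0r ow ->.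
by rewrite lee_fin; exact: h fM xm u0r ow.
Qed.

Lemma worst_case_short a b : 0 <= a -> a <= alphabar M -> 0 <= b -> b <= alphabar M ->
  (D (a, b) <= (sigma ^+ 2 * ((1 - b) ^+ 2 * ((1 - a) ^+ 2 * g + a ^+ 2) + b ^+ 2))%:E)%E.
Proof.
move=> a0 aM b0 bM; apply: worst_case_upper => d f x0 xs I o fM xm x0r oo.
apply: le_trans (short_steps_error M1 fM xm x0r oo a0 aM b0 bM) _.
by rewrite rhoE; le_by_eq; ring.
Qed.

Lemma worst_case_equal_steps : (D (alphabar M, alphabar M) <= (sigma ^+ 2 * V3 M g)%:E)%E.
Proof.
have ab : 0 <= alphabar M by rewrite /alphabar divr_ge0 //; have := M1; lra.
apply: le_trans (worst_case_short ab (lexx _) ab (lexx _)) _.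
rewrite lee_fin V3E ?(lt_trans ltr01) // /K2 /alphabar.
by le_by_eq; field; rewrite gt_eqF // addr_gt0 // (lt_trans ltr01).
Qed.

Lemma worst_case_hedged :
  (D (curve_a M (ahat M), curve_b M (ahat M)) <= (sigma ^+ 2 * V4 M g)%:E)%E.
Proof.
apply: worst_case_upper => d f x0 xs I o fM xm x0r oo.
apply: le_trans (hedged_error M1 fM xm x0r oo (ahat_gt1 M1) (ahat_hedging M1)) _.
by rewrite rhoE /V4; le_by_eq; ring.
Qed.

(** Up to gammastar both steps are short, and the first three values are
    those of the short-step bound. *)
Lemma worst_case_schedule : (D (schedule M g) <= (sigma ^+ 2 * Vstar M g)%:E)%E.
Proof.
have M1' := M1; have M0 : 0 < M by lra. have L0 : 0 < M - 1 by rewrite subr_gt0.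
rewrite /Vstar /schedule hedging_point //.
case: (leP g (gamma1 M)) => [g1|g1].
  have aM : g / (1 + g) <= alphabar M.
    have g0' := g0; rewrite /alphabar ler_pdivrMr; last lra.
    rewrite [leRHS]mulrAC ler_pdivlMr; last lra.
    by move: g1; rewrite /gamma1 ler_pdivlMr //; lra.
  have ba : g / (1 + 2 * g) <= g / (1 + g).
    by apply: ler_wpM2l => //; rewrite lef_pV2 ?posrE; have := g0; lra.
  have b0 : 0 <= g / (1 + 2 * g) by apply: divr_ge0 => //; have := g0; lra.
  apply: le_trans (worst_case_short (le_trans b0 ba) aM b0 (le_trans ba aM)) _.
  rewrite lee_fin /V1; le_by_eq; congr (_ * _).
  by field; have := g0; move=> g0'; rewrite !gt_eqF //; lra.
case: (leP g (gamma2 M)) => [g2|g2].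
  have ab : 0 <= alphabar M by rewrite /alphabar divr_ge0 //; lra.
  have K0 := K2_ge0 M g0.
  rewrite -[(_ + 4) / _]/(V2 M g).
  have bE := V2E M0 g0.
  have b0 : 0 <= V2 M g by rewrite bE divr_ge0 //; lra.
  have bM : V2 M g <= alphabar M.
    have q := mulr_ge0 g0 (sqr_ge0 (M - 1)).
    rewrite /V2 /alphabar ler_pdivrMr; last by have := sqr_ge0 (M + 1); lra.
    rewrite [leRHS]mulrAC ler_pdivlMr; last by lra.
    have h : 0 <= 2 * (M ^+ 2 + 3) - g * (M - 1) ^+ 3.
      by rewrite subr_ge0; move: g2; rewrite /gamma2 ler_pdivlMr // exprn_gt0.
    rewrite -subr_ge0; have -> : 2 * (g * (M - 1) ^+ 2 + 4 + (M + 1) ^+ 2) -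
      (g * (M - 1) ^+ 2 + 4) * (M + 1) = 2 * (M ^+ 2 + 3) - g * (M - 1) ^+ 3 by ring.
    exact: h.
  apply: le_trans (worst_case_short ab (lexx _) b0 bM) _.
  have -> : (1 - alphabar M) ^+ 2 * g + alphabar M ^+ 2 = K2 M g.
    by rewrite /alphabar /K2; field; rewrite gt_eqF //; lra.
  rewrite (complete_square _ K0) bE subrr expr0n /= mulr0 addr0; exact: lexx.
case: (ltgtP g (gammastar M)) => gg.
- exact: worst_case_equal_steps.
- exact: worst_case_hedged.
apply: le_trans worst_case_hedged _; rewrite lee_fin ler_pM2l //.
have := V34_gap M1 (ahat_gt1 M1) g.
rewrite -[hedged_value _ _ g]/(V4 M g) -[crossing _ _]/(gammastar M).
rewrite gg subrr mul0r; lra.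
Qed.

End WorstCase.

Theorem theorem1 (R : realType) (M rho sigma : R)
    (hM : 1 < M) (hrho : 0 <= rho) (hsigma : 0 < sigma) :
  let gamma := rho ^+ 2 / sigma ^+ 2 in
  let D := worst_case_error M rho sigma in
  [/\ gamma != gammastar M ->
        argmin_on (@stepsizes R) D = [set schedule M gamma],
      gamma = gammastar M ->
        argmin_on (@stepsizes R) D =
          [set (alphabar M, alphabar M);
               (2 / (1 + etaM M), 2 / (1 + 2 * M - etaM M))],
      argmin_on (@stepsizes R) D (schedule M gamma) /\
        D (schedule M gamma) = (sigma ^+ 2 * Vstar M gamma)%:E
    & [/\ V1 (gamma1 M) = V2 M (gamma1 M),
          V2 M (gamma2 M) = V3 M (gamma2 M)
        & V3 M (gammastar M) = V4 M (gammastar M)]].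
Proof.
move=> gamma D.
have g0 : 0 <= gamma by rewrite divr_ge0 ?sqr_ge0.
have lower := worst_case_lower hM hrho hsigma; rewrite -/gamma -/D in lower.
have sch := schedule_ge0 hM g0.
have DV : D (schedule M gamma) = (sigma ^+ 2 * Vstar M gamma)%:E.
  by apply/eqP; rewrite eq_le (@worst_case_schedule _ _ rho sigma hM hsigma) (lower _ sch).1.
have argP p : argmin_on (@stepsizes R) D p <->
    stepsizes p /\ D p = (sigma ^+ 2 * Vstar M gamma)%:E.
  split=> [[ps pm]|[ps pE]]; split; [exact: ps| |exact: ps|].
    apply/eqP; rewrite eq_le (lower _ ps).1 andbT -DV; exact: pm.
  by move=> q qs; rewrite pE; exact: (lower q qs).1.
have cross : V3 M (gammastar M) = V4 M (gammastar M).
  by apply/eqP; rewrite -subr_eq0 -[V4 _ _]/(hedged_value _ (ahat M) _)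
    V34_gap ?ahat_gt1 // subrr mul0r.
split.
- move=> gs; apply/seteqP; split=> p /=; last first.
    by move=> ->; apply/argP; split; [exact: sch | exact: DV].
  move=> /argP[ps pD]; have [->//|[gE]] := (lower _ ps).2 pD.
  by rewrite gE eqxx in gs.
- move=> gE; have [g1 g2] : gamma1 M < gamma /\ gamma2 M < gamma.
    have := gamma2_lt_crossing hM (ahat_gt1 hM).
    rewrite -[crossing _ _]/(gammastar M) -gE => h; split=> //.
    by apply: le_lt_trans h; exact: gamma12.
  have sE : schedule M gamma = (2 / (1 + etaM M), 2 / (1 + 2 * M - etaM M)).
    by rewrite /schedule leNgt g1 leNgt g2 /= gE ltxx.
  have VE : Vstar M gamma = V3 M gamma by rewrite /Vstar leNgt g1 leNgt g2 /= gE lexx.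
  apply/seteqP; split=> p /=.
    by move=> /argP[ps pD]; have [->|[_ ->]] := (lower _ ps).2 pD; [right|left].
  move=> [->|->]; apply/argP; last by rewrite -sE; split; [exact: sch | exact: DV].
  have ab : 0 <= alphabar M by rewrite /alphabar divr_ge0 // addr_ge0 // ltW // (lt_trans ltr01).
  have abS : stepsizes (alphabar M, alphabar M) by split.
  split; first exact: abS.
  apply/eqP; rewrite eq_le (lower _ abS).1 andbT VE.
  exact: worst_case_equal_steps.
- by split; [apply/argP; split; [exact: sch|]|]; exact: DV.
- by split=> //; [exact: V12_boundary | exact: V23_boundary].
Qed.
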